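(* Let $\mathbf{s}\in\mathcal{S}(m|n)$ and let $V_{\mathbf{s}}(\Lambda)$ be the irreducible highest weight representation of $\mathrm{U}_q(\mathfrak{g}_{\mathbf{s}})$ with highest weight $\Lambda=(\lambda_1,\dots,\lambda_N)$, $\lambda_j=q_j^{\Lambda_j}$. Suppose $s_is_{i+1}=01$ or $10$ for some $1\le i\le N-1$ and $\Lambda_i+\Lambda_{i+1}=0$. Then, via the odd reflection $\beta_{i,\mathbf{s}}$ and up to twisting by a sign automorphism, $V_{\mathbf{s}}(\Lambda)$ is isomorphic to the representation $V_{\sigma_i\mathbf{s}}(\Lambda^{[i]})$ of $\mathrm{U}_q(\mathfrak{g}_{\sigma_i\mathbf{s}})$, where $$\Lambda^{[i]}=\big(q_1^{\Lambda_1},\dots,q_{i-1}^{\Lambda_{i-1}},\,q_{i+1}^{\Lambda_{i+1}},\,q_i^{\Lambda_i},\,q_{i+2}^{\Lambda_{i+2}},\dots,q_N^{\Lambda_N}\big),$$ the numbers $q_j$ being those attached to $\mathbf{s}$. In this case $V_{\mathbf{s}}(\Lambda)$ and $V_{\sigma_i\mathbf{s}}(\Lambda^{[i]})$ share the same maximal vector.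
   Context: Everything is over $\mathbb{C}$; $q\in\mathbb{C}\setminus\{0\}$ is not a root of unity, with a fixed logarithm defining complex powers; $m,n\in\mathbb{Z}_{\ge0}$, $N=m+n\ge2$. $\mathcal{S}(m|n)$ is the set of sequences $\mathbf{s}=s_1\cdots s_N$ with exactly $m$ zeros and $n$ ones. Given $\mathbf{s}$: $|i|=\bar0$, $d_i=1$ if $s_i=0$, and $|i|=\bar1$, $d_i=-1$ if $s_i=1$; $q_i=q^{d_i}$. $\sigma_i\mathbf{s}$ is $\mathbf{s}$ with $s_i,s_{i+1}$ interchanged. Let $(\varepsilon_i|\varepsilon_j)=d_i\delta_{ij}$, $\alpha_i=\varepsilon_i-\varepsilon_{i+1}$; $[X,Y]_a=XY-(-1)^{|X||Y|}aYX$, $[X,Y]=[X,Y]_1$. $\mathrm{U}_q(\mathfrak{g}_{\mathbf{s}})$ is the quantum general linear superalgebra, here used in its Drinfeld–Jimbo form: generators $x_{i,\mathbf{s}}^\pm$ ($1\le i\le N-1$, parity $|i|+|i+1|$), $k_{a,\mathbf{s}}^{\pm1}$ ($1\le a\le N$, even), relations (dropping $\mathbf{s}$): $k_ak_a^{-1}=1=k_a^{-1}k_a$, $k_ak_b=k_bk_a$; $k_ax_i^\pm k_a^{-1}=q^{\pm(\varepsilon_a|\alpha_i)}x_i^\pm$; $[x_i^+,x_j^-]=\delta_{ij}\frac{k_ik_{i+1}^{-1}-k_i^{-1}k_{i+1}}{q_i-q_i^{-1}}$; $[x_i^\pm,x_j^\pm]=0$ if $(\alpha_i|\alpha_j)=0$;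 $[x_i^\pm,[x_i^\pm,x_\ell^\pm]_{q_i}]_{q_i^{-1}}=0$ if $(\alpha_i|\alpha_i)\ne0$, $\ell=i\pm1$; $[[[x_{i-1}^\pm,x_i^\pm]_{q_i},x_{i+1}^\pm]_{q_{i+1}},x_i^\pm]=0$ if $(\alpha_i|\alpha_i)=0$. (It is identified with the RTT presentation by $\bar t_{i,i+1}=(q_i-q_i^{-1})x_i^+k_i$, $t_{i+1,i}=-(q_i-q_i^{-1})k_i^{-1}x_i^-$, $\bar t_{aa}=t_{aa}^{-1}=k_a$.) A highest weight representation with highest weight $\Lambda=(\lambda_1,\dots,\lambda_N)\in(\mathbb{C}\setminus\{0\})^N$ is one generated by a nonzero vector $\zeta$ (maximal vector) with $x_i^+\zeta=0$ for all $i$ (equivalently $\bar t_{ij}\zeta=0$ for $i<j$) and $k_a\zeta=\lambda_a\zeta$. $V_{\mathbf{s}}(\Lambda)$ denotes the irreducible one. Sign automorphisms: $k_a\mapsto\epsilon_ak_a$, $x_i^+\mapsto x_i^+$, $x_i^-\mapsto\epsilon_i\epsilon_{i+1}x_i^-$ with $\epsilon_a\in\{\pm1\}$. Odd reflection: for $s_i\ne s_{i+1}$, $\mathbf{s}'=\sigma_i\mathbf{s}$, $d_j'=(-1)^{s_j'}$, the isomorphism $\beta_{i,\mathbf{s}}:\mathrm{U}_q(\mathfrak{g}_{\mathbf{s}})\to\mathrm{U}_q(\mathfrak{g}_{\mathbf{s}'})$ is given (right-hand sides in $\mathrm{U}_q(\mathfrak{g}_{\mathbf{s}'})$) by $k_i\mapsto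 d_i'k_{i+1}$, $k_{i+1}\mapsto d_{i+1}'k_i$, $k_a\mapsto k_a$ ($a\ne i,i+1$); $x_i^+\mapsto-d_{i+1}'x_i^-k_ik_{i+1}^{-1}$, $x_i^-\mapsto-d_i'k_{i+1}k_i^{-1}x_i^+$; $x_{i-1}^+\mapsto d_i'q^{-d_i'}[x_{i-1}^+,x_i^+]_{q^{d_i'}}$, $x_{i-1}^-\mapsto q^{d_i'}[x_i^-,x_{i-1}^-]_{q^{-d_i'}}$; $x_{i+1}^+\mapsto-d_{i+1}'[x_i^+,x_{i+1}^+]_{q^{-d_{i+1}'}}$, $x_{i+1}^-\mapsto-[x_{i+1}^-,x_i^-]_{q^{d_{i+1}'}}$; $x_r^\pm\mapsto x_r^\pm$ for $r\ne i,i\pm1$. ''Via the odd reflection'' means that $V_{\mathbf{s}}(\Lambda)$ is regarded as a $\mathrm{U}_q(\mathfrak{g}_{\mathbf{s}'})$-module through $\beta_{i,\mathbf{s}}^{-1}$. *)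

(* Defs.v *)
From HB Require Import structures.
From mathcomp Require Import all_boot all_order all_algebra perm.
From mathcomp Require Import all_classical all_reals sequences trigo.
From mathcomp Require Import complex.

Set Implicit Arguments.
Unset Strict Implicit.
Unset Printing Implicit Defensive.

Import Order.TTheory GRing.Theory Num.Theory.
Local Open Scope classical_set_scope.
Local Open Scope ring_scope.
Local Open Scope complex_scope.

Section ComplexPowers.
Variable R : realType.

Definition cexp (z : R[i]) : R[i] :=
  let: x +i* y := z in (expR x * cos y) +i* (expR x * sin y).

(* [lq] is the chosen logarithm of q. That of q_j = q^d (d = 1 or -1) is then
   d * lq, so this is the complex power q_j^z. *)
Definition qpow (lq : R[i]) (d : int) (z : R[i]) : R[i] :=
  cexp (d%:~R * lq * z).

End ComplexPowers.

(* The algebra of all linear endomorphisms of a vector space of arbitrary,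
   possibly infinite, dimension; the product is composition. *)
Section Endomorphisms.
Variables (F : fieldType) (V : lmodType F).

Definition endo : Type := {linear V -> V}.

HB.instance Definition _ := gen_eqMixin endo.
HB.instance Definition _ := gen_choiceMixin endo.

Implicit Types f g h : endo.

Lemma endoP f g : f =1 g -> f = g.
Proof.
move=> /funext; case: f g => [f [[a1] [a2]]] [g [[b1] [b2]]] /= fg.
by subst g; rewrite (Prop_irrelevance a1 b1) (Prop_irrelevance a2 b2).
Qed.

Definition endo0 : endo := \0.
Definition endoN f : endo := \- f.
Definition endoD f g : endo := f \+ g.
Definition endo1 : endo := idfun.
Definition endoM f g : endo := f \o g.
Definition endoZ (a : F) f : endo := a \*: f.

Fact endoDA : associative endoD.
Proof. by move=> f g h; apply: endoP => v /=; rewrite addrA. Qed.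
Fact endoDC : commutative endoD.
Proof. by move=> f g; apply: endoP => v /=; rewrite addrC. Qed.
Fact endo0D : left_id endo0 endoD.
Proof. by move=> f; apply: endoP => v /=; rewrite add0r. Qed.
Fact endoND : left_inverse endo0 endoN endoD.
Proof. by move=> f; apply: endoP => v /=; rewrite addNr. Qed.

HB.instance Definition _ :=
  GRing.isZmodule.Build endo endoDA endoDC endo0D endoND.

Fact endoMA : associative endoM.
Proof. by move=> f g h; apply: endoP. Qed.
Fact endo1M : left_id endo1 endoM.
Proof. by move=> f; apply: endoP. Qed.
Fact endoM1 : right_id endo1 endoM.
Proof. by move=> f; apply: endoP. Qed.
Fact endoMDl : left_distributive endoM +%R.
Proof. by move=> f g h; apply: endoP. Qed.
Fact endoMDr : right_distributive endoM +%R.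
Proof. by move=> f g h; apply: endoP => v /=; rewrite linearD. Qed.

HB.instance Definition _ :=
  GRing.Zmodule_isPzRing.Build endo endoMA endo1M endoM1 endoMDl endoMDr.

Fact endoZA a b f : endoZ a (endoZ b f) = endoZ (a * b) f.
Proof. by apply: endoP => v /=; rewrite scalerA. Qed.
Fact endo1Z : left_id 1 endoZ.
Proof. by move=> f; apply: endoP => v /=; rewrite scale1r. Qed.
Fact endoZDr : right_distributive endoZ +%R.
Proof. by move=> a f g; apply: endoP => v /=; rewrite scalerDr. Qed.
Fact endoZDl f : {morph endoZ^~ f : a b / a + b}.
Proof. by move=> a b; apply: endoP => v /=; rewrite scalerDl. Qed.

HB.instance Definition _ :=
  GRing.Zmodule_isLmodule.Build F endo endoZA endo1Z endoZDr endoZDl.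

Fact endoZAl a f g : a *: (f * g) = (a *: f) * g.
Proof. by apply: endoP. Qed.
Fact endoZAr a f g : a *: (f * g) = f * (a *: g).
Proof. by apply: endoP => v /=; rewrite linearZ. Qed.

End Endomorphisms.

(* Positions are a : 'I_N and nodes are i : 'I_N.-1, both counted from 0; node i
   joins the positions i and i + 1. *)
Section ParitySequences.
Variable N : nat.
Implicit Types (s : N.-tuple bool) (a b : 'I_N) (i j : 'I_N.-1).

Definition node_l i : 'I_N := widen_ord (leq_pred N) i.

Fact node_r_subproof i : (i.+1 < N)%N.
Proof. by rewrite -ltn_predRL. Qed.

Definition node_r i : 'I_N := Ordinal (node_r_subproof i).

Definition sgn s a : int := if tnth s a then -1 else 1.

Definition node_parity s i : bool :=
  tnth s (node_l i) (+) tnth s (node_r i).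

Definition swap_seq i s : N.-tuple bool :=
  [tuple tnth s (tperm (node_l i) (node_r i) a) | a < N].

(* The values (eps_a | eps_b), (eps_a | alpha_i) and (alpha_i | alpha_j) of the
   bilinear form, where alpha_i = eps_i - eps_(i+1). *)
Definition form_ee s a b : int := sgn s a *+ (a == b).

Definition form_ea s a i : int :=
  form_ee s a (node_l i) - form_ee s a (node_r i).

Definition form_aa s i j : int :=
  form_ea s (node_l i) j - form_ea s (node_r i) j.

End ParitySequences.

(* s has exactly m zeros (false) and n ones (true). *)
Definition parity_seq (m n : nat) (s : (m + n).-tuple bool) : bool :=
  (count_mem false s == m) && (count_mem true s == n).
Arguments parity_seq : clear implicits.

Inductive Uq_gen (N : nat) : Type :=
  | Xp of 'I_N.-1
  | Xm of 'I_N.-1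
  | K of 'I_N
  | Kinv of 'I_N.
Arguments Xp {N}. Arguments Xm {N}. Arguments K {N}. Arguments Kinv {N}.

Definition Xpm N (e : bool) (i : 'I_N.-1) : Uq_gen N :=
  if e then Xp i else Xm i.

(* A homogeneous element is represented by the pair (parity, element). *)
Definition sbracket (F : fieldType) (V : lmodType F) (a : F)
    (X Y : bool * endo V) : bool * endo V :=
  (X.1 (+) Y.1, X.2 * Y.2 - ((-1) ^+ (X.1 && Y.1) * a) *: (Y.2 * X.2)).

Section Representations.
Variables (F : fieldType) (N : nat).

(* The images of the generators in End V. *)
Definition Uq_ops (V : lmodType F) := Uq_gen N -> endo V.

Definition homX (s : N.-tuple bool) (V : lmodType F) (rho : Uq_ops V)
    (e : bool) (i : 'I_N.-1) : bool * endo V :=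
  (node_parity s i, rho (Xpm e i)).

(* By its presentation, a representation of U_q(g_s) on V amounts to operators
   on V that satisfy the defining relations. *)
Record Uq_rep (q : F) (s : N.-tuple bool) (V : lmodType F) (rho : Uq_ops V) :
    Prop := {
  Uq_KKinv : forall a, rho (K a) * rho (Kinv a) = 1;
  Uq_KinvK : forall a, rho (Kinv a) * rho (K a) = 1;
  Uq_KK : forall a b, rho (K a) * rho (K b) = rho (K b) * rho (K a);
  Uq_KX : forall a e i,
    rho (K a) * rho (Xpm e i) * rho (Kinv a)
      = q ^ ((-1) ^+ (~~ e) * form_ea s a i) *: rho (Xpm e i);
  Uq_XpXm : forall i j,
    (sbracket 1 (homX s rho true i) (homX s rho false j)).2
      = if i == j then
          let qi := q ^ sgn s (node_l i) in
          (qi - qi^-1)^-1 *: (rho (K (node_l i)) * rho (Kinv (node_r i))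
                              - rho (Kinv (node_l i)) * rho (K (node_r i)))
        else 0;
  Uq_XX : forall e i j, form_aa s i j = 0 ->
    (sbracket 1 (homX s rho e i) (homX s rho e j)).2 = 0;
  Uq_Serre3 : forall e (i l : 'I_N.-1), form_aa s i i != 0 ->
    (l = i.+1 :> nat \/ i = l.+1 :> nat) ->
    let qi := q ^ sgn s (node_l i) in
    (sbracket qi^-1 (homX s rho e i)
       (sbracket qi (homX s rho e i) (homX s rho e l))).2 = 0;
  Uq_Serre4 : forall e (j i l : 'I_N.-1), form_aa s i i = 0 ->
    i = j.+1 :> nat -> l = i.+1 :> nat ->
    let qi := q ^ sgn s (node_l i) in
    let qi1 := q ^ sgn s (node_r i) in
    (sbracket 1
       (sbracket qi1 (sbracket qi (homX s rho e j) (homX s rho e i))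
          (homX s rho e l))
       (homX s rho e i)).2 = 0
}.

Definition subrep (V : lmodType F) (rho : Uq_ops V) (W : set V) : Prop :=
  [/\ W 0,
      forall (a : F) u v, W u -> W v -> W (a *: u + v)
    & forall g v, W v -> W (rho g v)].

Definition irreducible_rep (V : lmodType F) (rho : Uq_ops V) : Prop :=
  (exists v : V, v != 0) /\
  forall W : set V, subrep rho W -> W = [set 0] \/ W = setT.

(* The representation is generated by its maximal vector zeta. *)
Definition highest_weight_rep (lam : 'I_N -> F) (V : lmodType F)
    (rho : Uq_ops V) (zeta : V) : Prop :=
  [/\ zeta != 0,
      forall W : set V, subrep rho W -> W zeta -> W = setT,
      forall i, rho (Xp i) zeta = 0
    & forall a, rho (K a) zeta = lam a *: zeta].

(* V_s(lam) is unique up to isomorphism only: rho is a copy of it, with maximal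
   vector zeta. *)
Definition is_Virr (q : F) (s : N.-tuple bool) (lam : 'I_N -> F)
    (V : lmodType F) (rho : Uq_ops V) (zeta : V) : Prop :=
  [/\ Uq_rep q s rho, irreducible_rep rho & highest_weight_rep lam rho zeta].

Definition intertwines (V W : lmodType F) (rho : Uq_ops V) (tau : Uq_ops W)
    (phi : {linear V -> W}) : Prop :=
  forall g v, phi (rho g v) = tau g (phi v).

(* The sign attached to a position is (-1) ^+ eps a. *)
Definition sign_twist (eps : 'I_N -> bool) (V : lmodType F) (rho : Uq_ops V) :
    Uq_ops V := fun g =>
  match g with
  | Xp i => rho (Xp i)
  | Xm i => (-1) ^+ (eps (node_l i) (+) eps (node_r i)) *: rho (Xm i)
  | K a => (-1) ^+ eps a *: rho (K a)
  | Kinv a => (-1) ^+ eps a *: rho (Kinv a)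
  end.

(* For a representation rho of U_q(g_s'), the images of the generators of
   U_q(g_s), s = sigma_i s', under the composite of beta_{i,s} with rho. *)
Definition odd_reflection (q : F) (s' : N.-tuple bool) (i : 'I_N.-1)
    (V : lmodType F) (rho : Uq_ops V) : Uq_ops V := fun g =>
  let d : int := sgn s' (node_l i) in
  let d1 : int := sgn s' (node_r i) in
  let ki := rho (K (node_l i)) in
  let ki1 := rho (K (node_r i)) in
  let kVi := rho (Kinv (node_l i)) in
  let kVi1 := rho (Kinv (node_r i)) in
  let x := homX s' rho in
  match g with
  | Xp j =>
      if j == i then - d1%:~R *: (rho (Xm i) * ki * kVi1)
      else if i == j.+1 :> nat then
        (d%:~R * q ^ (- d)) *: (sbracket (q ^ d) (x true j) (x true i)).2
      else if j == i.+1 :> nat then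
        - d1%:~R *: (sbracket (q ^ (- d1)) (x true i) (x true j)).2
      else rho (Xp j)
  | Xm j =>
      if j == i then - d%:~R *: (ki1 * kVi * rho (Xp i))
      else if i == j.+1 :> nat then
        q ^ d *: (sbracket (q ^ (- d)) (x false i) (x false j)).2
      else if j == i.+1 :> nat then
        - (sbracket (q ^ d1) (x false j) (x false i)).2
      else rho (Xm j)
  | K a =>
      if a == node_l i then d%:~R *: ki1
      else if a == node_r i then d1%:~R *: ki
      else rho (K a)
  | Kinv a =>
      if a == node_l i then d%:~R *: kVi1
      else if a == node_r i then d1%:~R *: kVi
      else rho (Kinv a)
  end.

End Representations.

(* Transporting a representation through the inverse of beta_{i,s}: sigma is
   the representation of U_q(g_{sigma_i s}) on V whose composite with
   beta_{i,s} is rho. *)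
Definition via_odd_reflection (F : fieldType) (N : nat) (q : F)
    (s : N.-tuple bool) (i : 'I_N.-1) (V : lmodType F)
    (rho sigma : Uq_ops N V) : Prop :=
  Uq_rep q (swap_seq i s) sigma /\
  forall g, odd_reflection q (swap_seq i s) i sigma g = rho g.

(* Main.v *)
(* Call the relations other than those between two x^+ or two x^- the core
   relations. In an irreducible highest weight module they imply all the others:
   if u is one of the remaining relators in the x^+, then u skew-commutes with
   every x_j^- and kills the maximal vector, so it kills everything; if u is a
   relator in the x^-, then u skew-commutes with every x_j^+ and its image avoids
   the top weight space, so this image lies in a proper subrepresentation, which
   is 0.

   Solving the formulas of the odd reflection for the generators of
   U_q(g_{sigma_i s}) gives operators on V for which only the core relations have
   to be checked. Since Lambda_i + Lambda_{i+1} = 0 means lambda_i = lambda_{i+1},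
   the vector x_i^- zeta is singular, hence 0; so zeta stays maximal, the signs of
   its new weight being absorbed by the twist. Isomorphism with any other model
   comes from the uniqueness of irreducible highest weight modules. *)

Require Import Defs.
From HB Require Import structures.
From mathcomp Require Import all_boot all_order all_algebra perm.
From mathcomp Require Import all_classical all_reals sequences trigo.
From mathcomp Require Import complex ring zify.

Set Implicit Arguments.
Unset Strict Implicit.
Unset Printing Implicit Defensive.

Import Order.TTheory GRing.Theory Num.Theory.
Local Open Scope ring_scope.
Local Open Scope complex_scope.

(** * Comparing linear combinations coefficientwise *)

(** A representation is only a family of operators on a space of arbitrary dimension: no Verma
    module, contravariant form or weight decomposition is at hand. The grading is replaced by one
    operator, [height], a product of powers of the k_a, whose eigenvalues every x_j^- multiplies by
    q; as q is not a root of unity, [deep] then gives a meaning to lying strictly below the maximal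
    vector. The Verma module is replaced by the graph [nspan], built from lowering operators alone
    and stable under all generators by the core relations. Working with core relations spares the
    Serre relators of the reflected generators, some of which are themselves q-brackets. There is no
    circularity: the operators of [rho] are polynomials in the reflected ones, so irreducibility
    passes to the latter before any Serre relation is known for them. On the other hand, the core
    relations after reflection need more than those before it: the new x_i^+ is essentially the old
    x_i^-, so some mixed relations turn into relations between two old x^+ or two old x^-, and
    (x_i^+)^2 = (x_i^-)^2 = 0 is used throughout. *)

Inductive lexp (F : Type) : Type :=
  | LVar of nat
  | LZero
  | LAdd of lexp F & lexp F
  | LOpp of lexp F
  | LScale of F & lexp F.
Arguments LVar {F}. Arguments LZero {F}.

Section LinearExpressions.
Variables (F : fieldType) (V : lmodType F).

Fixpoint leval (env : seq V) (e : lexp F) : V :=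
  match e with
  | LVar n => nth 0 env n
  | LZero => 0
  | LAdd e1 e2 => leval env e1 + leval env e2
  | LOpp e1 => - leval env e1
  | LScale a e1 => a *: leval env e1
  end.

(* [None] stands for a zero coefficient, so that the coefficients obtained by
   computation stay small. *)
Fixpoint lcoef (n : nat) (e : lexp F) : option F :=
  match e with
  | LVar m => if Nat.eqb m n then Some 1 else None
  | LZero => None
  | LAdd e1 e2 =>
      match lcoef n e1, lcoef n e2 with
      | None, c => c
      | c, None => c
      | Some a, Some b => Some (a + b)
      end
  | LOpp e1 => if lcoef n e1 is Some a then Some (- a) else None
  | LScale a e1 => if lcoef n e1 is Some b then Some (a * b) else None
  end.

Definition same_coef (c1 c2 : option F) : Prop :=
  match c1, c2 with
  | None, None => True
  | None, Some b => 0 = b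
  | Some a, None => a = 0
  | Some a, Some b => a = b
  end.

Fixpoint same_coefs (k : nat) (e1 e2 : lexp F) : Prop :=
  match k with
  | 0%N => True
  | k'.+1 => same_coef (lcoef k' e1) (lcoef k' e2) /\ same_coefs k' e1 e2
  end.

Lemma levalE (env : seq V) (e : lexp F) :
  leval env e = \sum_(n < size env) odflt 0 (lcoef n e) *: env`_n.
Proof.
have eqbE (a b : nat) : Nat.eqb a b = (a == b).
  by apply/idP/eqP => /PeanoNat.Nat.eqb_eq.
elim: e => [n||e1 IH1 e2 IH2|e IH|a e IH] /=.
- case: (ltnP n (size env)) => hn; last first.
    rewrite nth_default // big1 // => j _; rewrite eqbE.
    by rewrite gtn_eqF ?scale0r // (leq_trans (ltn_ord j)).
  rewrite (bigD1 (Ordinal hn)) //= eqbE eqxx scale1r big1 ?addr0 // => j hj.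
  by rewrite eqbE eq_sym -(inj_eq val_inj) /= in hj *; rewrite (negPf hj) scale0r.
- by rewrite big1 // => j _; rewrite scale0r.
- rewrite IH1 IH2 -big_split; apply: eq_bigr => j _ /=.
  by case: (lcoef j e1) (lcoef j e2) => [a|] [b|];
    rewrite /= ?scale0r ?add0r ?addr0 // scalerDl.
- rewrite IH -sumrN; apply: eq_bigr => j _.
  by case: (lcoef j e) => [a|] /=; rewrite ?scaleNr // scale0r oppr0.
- rewrite IH scaler_sumr; apply: eq_bigr => j _.
  by case: (lcoef j e) => [b|] /=; rewrite ?scale0r ?scaler0 ?scalerA.
Qed.

(** A sufficient condition only, as the atoms in [env] may be linearly dependent; uses of it first
    rewrite both sides into a common normal order. *)
Lemma lexp_eq (env : seq V) (e1 e2 : lexp F) :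
  same_coefs (size env) e1 e2 -> leval env e1 = leval env e2.
Proof.
rewrite !levalE => h; apply: eq_bigr => j _; congr (_ *: _).
suff : same_coef (lcoef j e1) (lcoef j e2).
  by case: (lcoef j e1) (lcoef j e2) => [a|] [b|].
elim: (size env) h j => [_ []//|k IH /= [hk hs] j].
case: (ltnP j k) => hj; first exact: (IH hs (Ordinal hj)).
by have -> : j = k :> nat by apply/eqP; rewrite eqn_leq hj -ltnS ltn_ord.
Qed.

(* Keeps rewriting with linearity from matching [- v] or [a *: v], which are
   themselves instances of linear maps. *)
Definition ap (f : endo V) (v : V) : V := f v.


Lemma apD f u v : ap f (u + v) = ap f u + ap f v.
Proof. exact: linearD. Qed.
Lemma apN f u : ap f (- u) = - ap f u.
Proof. exact: linearN. Qed.
Lemma apZ f a u : ap f (a *: u) = a *: ap f u.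
Proof. exact: linearZ. Qed.
Lemma ap0 f : ap f 0 = 0.
Proof. exact: linear0. Qed.
Definition ap_lin := (apD, apN, apZ, ap0).

Lemma ap_add f g v : ap (f + g) v = ap f v + ap g v. Proof. by []. Qed.
Lemma ap_opp f v : ap (- f) v = - ap f v. Proof. by []. Qed.
Lemma ap_mul f g v : ap (f * g) v = ap f (ap g v). Proof. by []. Qed.
Lemma ap_scale a f v : ap (a *: f) v = a *: ap f v. Proof. by []. Qed.
Lemma ap_zero v : ap 0 v = 0. Proof. by []. Qed.
Lemma ap_one v : ap 1 v = v. Proof. by []. Qed.
Lemma ap_sbracket a (X Y : bool * endo V) v :
  ap (sbracket a X Y).2 v
    = ap X.2 (ap Y.2 v) - ((-1) ^+ (X.1 && Y.1) * a) *: ap Y.2 (ap X.2 v).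
Proof. by []. Qed.
Lemma sbracket_par a (X Y : bool * endo V) :
  (sbracket a X Y).1 = X.1 (+) Y.1.
Proof. by []. Qed.

Definition apE :=
  (sbracket_par, ap_sbracket, ap_add, ap_opp, ap_mul, ap_scale, ap_zero, ap_one).

Lemma ap_ext f g : (forall v, ap f v = ap g v) -> f = g.
Proof. exact: endoP. Qed.

End LinearExpressions.
Arguments ap : simpl never.
Arguments sbracket : simpl never.

(* [match constr:(Set) with _ => ... end] lets a test run inside an Ltac that
   returns a term. *)
Ltac lmem a l :=
  match l with
  | @nil _ => constr:(false)
  | ?b :: ?l' =>
      match constr:(Set) with
      | _ => let _ := match constr:(Set) with _ => constr_eq a b end in constr:(true)
      | _ => lmem a l'
      end
  end.
Ltac lidx a l :=
  match l with
  | ?b :: ?l' =>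
      match constr:(Set) with
      | _ => let _ := match constr:(Set) with _ => constr_eq a b end in constr:(0%N)
      | _ => let k := lidx a l' in constr:(S k)
      end
  end.
Ltac latoms t l :=
  match t with
  | (?a + ?b)%R => let l1 := latoms a l in latoms b l1
  | (- ?a)%R => latoms a l
  | (?c *: ?a)%R => latoms a l
  | 0%R => l
  | _ => match lmem t l with
         | true => l
         | false => constr:(t :: l)
         end
  end.
Ltac lreify F t l :=
  match t with
  | (?a + ?b)%R =>
      let ea := lreify F a l in let eb := lreify F b l in
      constr:(@LAdd F ea eb)
  | (- ?a)%R => let ea := lreify F a l in constr:(@LOpp F ea)
  | (?c *: ?a)%R => let ea := lreify F a l in constr:(@LScale F c ea)
  | 0%R => constr:(@LZero F)
  | _ => let k := lidx t l in constr:(@LVar F k)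
  end.

(* Reduces an equality of linear combinations in V to equalities between the
   coefficients of each atom, which are passed to [tac]. *)
Ltac lcomb F V tac :=
  match goal with
  | |- ?a = ?b =>
      let l0 := constr:(@nil V) in
      let l1 := latoms a l0 in
      let l := latoms b l1 in
      let ea := lreify (GRing.Field.sort F) a l in
      let eb := lreify (GRing.Field.sort F) b l in
      change (@leval F _ l ea = @leval F _ l eb);
      apply: lexp_eq; cbn [size same_coefs same_coef lcoef Nat.eqb];
      repeat (split; [first [exact I | tac]|]); try exact I
  end.

(** * The core relations *)

Record Uq_core (F : fieldType) (N : nat) (q : F) (s : N.-tuple bool)
    (V : lmodType F) (rho : Uq_ops N V) : Prop := {
  core_KKinv : forall a, rho (K a) * rho (Kinv a) = 1;
  core_KinvK : forall a, rho (Kinv a) * rho (K a) = 1;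
  core_KK : forall a b, rho (K a) * rho (K b) = rho (K b) * rho (K a);
  core_KX : forall a e i,
    rho (K a) * rho (Xpm e i) * rho (Kinv a)
      = q ^ ((-1) ^+ (~~ e) * form_ea s a i) *: rho (Xpm e i);
  core_XpXm : forall i j,
    (sbracket 1 (homX s rho true i) (homX s rho false j)).2
      = if i == j then
          let qi := q ^ sgn s (node_l i) in
          (qi - qi^-1)^-1 *: (rho (K (node_l i)) * rho (Kinv (node_r i))
                              - rho (Kinv (node_l i)) * rho (K (node_r i)))
        else 0
}.

(** * The bilinear form on simple roots *)

Section ParityForms.
Variables (N : nat) (s : N.-tuple bool).
Implicit Types i j : 'I_N.-1.

Lemma node_lr i : node_l i != node_r i.
Proof. by rewrite -(inj_eq val_inj) /= neq_ltn ltnSn. Qed.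

Lemma form_aaE i j :
  form_aa s i j =
    sgn s (node_l i) * ((i == j :> nat)%:R - (i == j.+1 :> nat)%:R)
    - sgn s (node_r i) * ((i.+1 == j :> nat)%:R - (i == j :> nat)%:R).
Proof.
rewrite /form_aa /form_ea /form_ee -!(inj_eq val_inj) /= eqSS.
by move: (_ == _) (_ == _) (_ == _) (sgn _ _) (sgn _ _) => [] [] [] x y /=; ring.
Qed.

Lemma sgn_parity i :
  sgn s (node_r i) = (-1) ^+ node_parity s i * sgn s (node_l i).
Proof.
rewrite /node_parity /sgn.
by case: (tnth s (node_l i)); case: (tnth s (node_r i)).
Qed.

Lemma sgnP a : sgn s a = 1 \/ sgn s a = -1.
Proof. by rewrite /sgn; case: (tnth s a); [right|left]. Qed.

Lemma form_aa_diag i :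
  form_aa s i i = if node_parity s i then 0 else sgn s (node_l i) *+ 2.
Proof.
rewrite form_aaE sgn_parity eqxx [_ == i.+1]ltn_eqF // [i.+1 == _]gtn_eqF // mulr1n mulr0n.
case: node_parity; rewrite ?expr0 ?expr1 ?mul1r subr0 sub0r mulr1 mulrN1 opprK ?mulN1r.
  exact: subrr.
exact: mulr2n.
Qed.

(** (alpha_i | alpha_i) = d_i + d_{i+1}, and the two signs cancel exactly at an odd node. *)
Lemma form_aa_diag0 i : (form_aa s i i == 0) = node_parity s i.
Proof.
rewrite form_aa_diag; case: node_parity; rewrite ?eqxx //.
by case: (sgnP (node_l i)) => ->.
Qed.

Lemma form_aa_prev i j : i = j.+1 :> nat ->
  form_aa s i j = - sgn s (node_l i).
Proof.
move=> h; rewrite form_aaE h eqxx /= [j.+1 == j]gtn_eqF //.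
by rewrite [j.+2 == j]gtn_eqF // mulr1n mulr0n sub0r mulrN1 subr0 mulr0 subr0.
Qed.

Lemma form_aa_next i j : j = i.+1 :> nat ->
  form_aa s i j = - sgn s (node_r i).
Proof.
move=> h; rewrite form_aaE h eqxx /= [(i : nat) == i.+1]ltn_eqF //.
by rewrite [(i : nat) == i.+2]ltn_eqF // mulr1n mulr0n !subr0 mulr0 sub0r mulr1.
Qed.

Lemma sgn_adjacent i j : j = i.+1 :> nat ->
  sgn s (node_l j) = sgn s (node_r i).
Proof. by move=> h; congr (sgn s _); apply: val_inj. Qed.

Lemma form_aa_far i j :
  i != j -> i != j.+1 :> nat -> j != i.+1 :> nat -> form_aa s i j = 0.
Proof.
rewrite -(inj_eq val_inj) form_aaE => /negPf -> /negPf ->.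
by rewrite eq_sym => /negPf ->; rewrite !subr0 !mulr0 subr0.
Qed.

Lemma form_aaC i j : form_aa s i j = form_aa s j i.
Proof.
have [->//|nij] := eqVneq i j.
have [e|n1] := eqVneq (i : nat) j.+1.
  by rewrite form_aa_prev // form_aa_next // (sgn_adjacent e).
have [e|n2] := eqVneq (j : nat) i.+1.
  by rewrite form_aa_next // form_aa_prev // (sgn_adjacent e).
by rewrite !form_aa_far // eq_sym.
Qed.

End ParityForms.

Section SuperCommutation.
Variables (F : fieldType) (V : lmodType F).
Implicit Types X Y Z : bool * endo V.

Definition scomm X Y : Prop := forall v,
  ap X.2 (ap Y.2 v) = (-1) ^+ (X.1 && Y.1) *: ap Y.2 (ap X.2 v).

Lemma scommP X Y : (sbracket 1 X Y).2 = 0 <-> scomm X Y.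
Proof.
split=> [h v|h]; last first.
  by apply: ap_ext => v; rewrite ap_sbracket h mulr1 subrr ap_zero.
have := congr1 (fun f => ap f v) h.
by rewrite ap_sbracket ap_zero mulr1 => /subr0_eq.
Qed.

Lemma scomm_sym X Y : scomm X Y -> scomm Y X.
Proof.
by move=> h v; rewrite h scalerA andbC -signr_addb addbb expr0 scale1r.
Qed.

Lemma scomm_scale a b X Y : scomm X Y -> scomm (X.1, a *: X.2) (Y.1, b *: Y.2).
Proof.
by move=> h v; rewrite /= !apE !ap_lin h !scalerA; congr (_ *: _); ring.
Qed.

(** Holds for every parameter a, because moving Z past both products costs the same sign. Hence a
    relator needs a computation only against generators opposite to one of its letters. *)
Lemma scomm_sbracket a X Y Z :
  scomm X Z -> scomm Y Z -> scomm (sbracket a X Y) Z.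
Proof.
move=> hX hY v; rewrite !apE /= hY !ap_lin hX !(hX, hY, ap_lin) !scalerDr !scalerN !scalerA.
by congr (_ *: _ - _ *: _); case: X.1; case: Y.1; case: Z.1; rewrite /= ?expr0 ?expr1; ring.
Qed.

End SuperCommutation.

Section CoreRelations.
Variables (F : fieldType) (N : nat) (q : F) (s : N.-tuple bool).
Variables (V : lmodType F) (rho : Uq_ops N V).
Hypotheses (q0 : q != 0) (core : Uq_core q s rho).
Implicit Types (e f : bool) (a b : 'I_N) (i j : 'I_N.-1) (v : V).

Definition kap f i : endo V :=
  if f then rho (K (node_l i)) * rho (Kinv (node_r i))
  else rho (Kinv (node_l i)) * rho (K (node_r i)).

Arguments kap : simpl never.

(** The coefficient in [x_i^+, x_i^-] for [e = true]; for [e = false], the one found by solving that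
    relation for the reverse order. It lets x^+ and x^- be treated uniformly from here on. *)
Definition xcoef e i : F :=
  let qi := q ^ sgn s (node_l i) in
  if e then (qi - qi^-1)^-1 else - ((-1) ^+ node_parity s i * (qi - qi^-1)^-1).

Lemma KVK a v : ap (rho (Kinv a)) (ap (rho (K a)) v) = v.
Proof. by rewrite -ap_mul (core_KinvK core). Qed.

Lemma KKV a v : ap (rho (K a)) (ap (rho (Kinv a)) v) = v.
Proof. by rewrite -ap_mul (core_KKinv core). Qed.

Lemma KKC a b v : ap (rho (K a)) (ap (rho (K b)) v) = ap (rho (K b)) (ap (rho (K a)) v).
Proof. by rewrite -ap_mul (core_KK core). Qed.

Lemma KKVC a b v :
  ap (rho (K a)) (ap (rho (Kinv b)) v) = ap (rho (Kinv b)) (ap (rho (K a)) v).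
Proof. by rewrite -[LHS](KVK b) -KKC KKV. Qed.

Lemma KVKVC a b v :
  ap (rho (Kinv a)) (ap (rho (Kinv b)) v) = ap (rho (Kinv b)) (ap (rho (Kinv a)) v).
Proof. by rewrite -[LHS](KVK b) KKVC KKV. Qed.

Lemma KX a e i v :
  ap (rho (K a)) (ap (rho (Xpm e i)) v)
    = q ^ ((-1) ^+ (~~ e) * form_ea s a i) *: ap (rho (Xpm e i)) (ap (rho (K a)) v).
Proof. by rewrite -ap_scale -(core_KX core) !ap_mul KVK. Qed.

Lemma KVX a e i v :
  ap (rho (Kinv a)) (ap (rho (Xpm e i)) v)
    = q ^ (- ((-1) ^+ (~~ e) * form_ea s a i))
        *: ap (rho (Xpm e i)) (ap (rho (Kinv a)) v).
Proof.
rewrite -{1}[v](KKV a) -[in RHS]exprz_inv.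
set z := (_ * _ : int); have z0 : q ^ z != 0 by rewrite expfz_neq0.
apply: (scalerI z0); rewrite scalerA exprz_inv -expfzDr // subrr expr0z scale1r.
by rewrite -ap_lin -KX KVK.
Qed.

Lemma kapX f e i j v :
  ap (kap f i) (ap (rho (Xpm e j)) v)
    = q ^ ((-1) ^+ (~~ f) * (-1) ^+ (~~ e) * form_aa s i j)
        *: ap (rho (Xpm e j)) (ap (kap f i) v).
Proof.
rewrite /kap /form_aa; case: f; rewrite !ap_mul.
  by rewrite KVX ap_lin KX scalerA -expfzDr // expr0; congr (q ^ _ *: _); ring.
by rewrite KX ap_lin KVX scalerA -expfzDr // expr1; congr (q ^ _ *: _); ring.
Qed.

Lemma kapK f i v : ap (kap f i) (ap (kap (~~ f) i) v) = v.
Proof.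
rewrite /kap; case: f; rewrite !ap_mul.
  by rewrite [X in ap _ X]KVKVC KVK KKV.
by rewrite [X in ap _ X]KKC KKV KVK.
Qed.

Lemma XX e i j v :
  ap (rho (Xpm e i)) (ap (rho (Xpm (~~ e) j)) v)
    = (-1) ^+ (node_parity s i && node_parity s j)
        *: ap (rho (Xpm (~~ e) j)) (ap (rho (Xpm e i)) v)
      + (if i == j then xcoef e i *: (ap (kap true i) v - ap (kap false i) v) else 0).
Proof.
have pm k l w : ap (rho (Xp k)) (ap (rho (Xm l)) w)
    = (-1) ^+ (node_parity s k && node_parity s l)
        *: ap (rho (Xm l)) (ap (rho (Xp k)) w)
      + (if k == l then xcoef true k *: (ap (kap true k) w - ap (kap false k) w) else 0).
  have := congr1 (fun g => ap g w) (core_XpXm core k l).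
  rewrite ap_sbracket /= mulr1 => /(canRL (subrK _)) ->; rewrite addrC; congr (_ + _).
  by case: eqP.
case: e => /=; first exact: pm.
rewrite (pm j i) eq_sym andbC; case: eqVneq => [->|_]; last first.
  rewrite !addr0 scalerA -signr_addb addbb expr0 scale1r //.
rewrite andbb /xcoef; case: node_parity; rewrite ?expr0 ?expr1;
  by lcomb F V ltac:(by ring).
Qed.

End CoreRelations.
Arguments kap : simpl never.

(** * The filtration by depth below the maximal vector *)

Section HeightOperator.
Variables (F : fieldType) (N : nat) (q : F) (s : N.-tuple bool).
Variables (V : lmodType F) (rho : Uq_ops N V).
Variables (lam : 'I_N -> F) (zeta : V).
Hypotheses (q0 : q != 0) (core : Uq_core q s rho) (zeta0 : zeta != 0).
Hypothesis K_zeta : forall a, ap (rho (K a)) zeta = lam a *: zeta.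

Lemma lam_neq0 a : lam a != 0.
Proof.
apply: contra_neq zeta0 => lam0.
by rewrite -(KVK core a zeta) K_zeta lam0 scale0r ap_lin.
Qed.

Lemma Kinv_zeta a : ap (rho (Kinv a)) zeta = (lam a)^-1 *: zeta.
Proof.
apply: (scalerI (lam_neq0 a)).
by rewrite -ap_lin -K_zeta (KVK core) scalerA divff ?lam_neq0 // scale1r.
Qed.

(** This is k_a^{d_a}: the exponent cancels the sign d_a in (eps_a | alpha_j), so parities disappear
    from the commutation with x_j^-. *)
Definition unit_coweight a : endo V :=
  if tnth s a then rho (Kinv a) else rho (K a).

Lemma unit_coweightX a j v :
  ap (unit_coweight a) (ap (rho (Xm j)) v)
    = (if a == node_l j then q^-1 else if a == node_r j then q else 1)
        *: ap (rho (Xm j)) (ap (unit_coweight a) v).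
Proof.
have := KX core a false j v; have := KVX q0 core a false j v.
rewrite /unit_coweight /form_ea /form_ee /sgn /=; case: (tnth s a) => hV hK.
  rewrite hV; congr (_ *: _); case: (eqVneq a) => [->|nl].
    by rewrite (negPf (node_lr j)).
  by case: (eqVneq a).
rewrite hK; congr (_ *: _); case: (eqVneq a) => [->|nl].
  by rewrite (negPf (node_lr j)).
by case: (eqVneq a).
Qed.

(* The product of the K_a^(d_a a). *)
Definition height : endo V := \prod_(a < N) unit_coweight a ^+ a.

Lemma height_ind (P : endo V -> Prop) :
  P 1 -> (forall f g, P f -> P g -> P (f * g)) ->
  (forall a, P (rho (K a))) -> (forall a, P (rho (Kinv a))) -> P height.
Proof.
move=> P1 PM PK PKV; apply: big_ind => // a _.
elim: (a : nat) => [|k IH]; rewrite ?expr0 // exprS; apply: PM => //.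
by rewrite /unit_coweight; case: (tnth s a).
Qed.

Lemma height_zeta : exists2 c, c != 0 & ap height zeta = c *: zeta.
Proof.
apply: (height_ind (P := fun f => exists2 c, c != 0 & ap f zeta = c *: zeta)).
- by exists 1; rewrite ?oner_neq0 // scale1r.
- move=> f g [c c0 hc] [d d0 hd]; exists (c * d); first exact: mulf_neq0.
  by rewrite ap_mul hd ap_lin hc scalerA mulrC.
- by move=> a; exists (lam a); rewrite ?lam_neq0.
- by move=> a; exists (lam a)^-1; rewrite ?invr_eq0 ?lam_neq0 // Kinv_zeta.
Qed.

Lemma heightK a v : ap (rho (K a)) (ap height v) = ap height (ap (rho (K a)) v).
Proof.
elim/height_ind: height v => // [f g hf hg v|b v|b v].
- by rewrite !ap_mul hf hg.
- exact: (KKC core).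
- exact: (KKVC core).
Qed.

Lemma heightKV a v :
  ap (rho (Kinv a)) (ap height v) = ap height (ap (rho (Kinv a)) v).
Proof. by rewrite -{1}[v](KKV core a) -heightK (KVK core). Qed.

(** The two ends of node j contribute (q^-1)^j and q^(j+1), hence the same factor q for every j; the
    exponents in [height] are chosen for this. *)
Lemma heightX j v :
  ap height (ap (rho (Xm j)) v) = q *: ap (rho (Xm j)) (ap height v).
Proof.
pose c a : F := if a == node_l j then q^-1 else if a == node_r j then q else 1.
pose R (f : endo V) (b : F) :=
  forall w, ap f (ap (rho (Xm j)) w) = b *: ap (rho (Xm j)) (ap f w).
have R1 : R 1 1 by move=> w; rewrite scale1r.
have RM f g b d : R f b -> R g d -> R (f * g) (b * d).
  by move=> hf hg w; rewrite !ap_mul hg ap_lin hf scalerA mulrC.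
have : R height (\prod_(a < N) c a ^+ a).
  apply: (big_ind2 R) => // [f b g d|a _]; first exact: RM.
  elim: (a : nat) => [|k IH]; rewrite ?expr0 // !exprS; apply: RM => // w.
  exact: unit_coweightX.
move=> ->; congr (_ *: _).
rewrite (bigD1 (node_l j)) //= (bigD1 (node_r j)) /=; last first.
  by rewrite eq_sym node_lr.
rewrite big1 ?mulr1; last first.
  by move=> a /andP[/negPf nl /negPf nr]; rewrite /c nl nr expr1n.
rewrite /c eqxx eq_sym (negPf (node_lr j)) eqxx exprS mulrCA -exprMn mulVf //.
by rewrite expr1n mulr1.
Qed.

End HeightOperator.

Section Depth.
Variables (F : fieldType) (N : nat) (q : F) (V : lmodType F).
Variables (H : endo V) (c : F) (zeta : V) (x : 'I_N.-1 -> endo V).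
Hypotheses (q0 : q != 0) (q_root : forall k : nat, (0 < k)%N -> q ^+ k != 1).
Hypotheses (c0 : c != 0) (zeta0 : zeta != 0) (H_zeta : ap H zeta = c *: zeta).
Hypothesis HX : forall j v, ap H (ap (x j) v) = q *: ap (x j) (ap H v).

(** The product of the commuting operators H - c q^k, m <= k < m + n, applied to v. Being killed by
    it replaces being a sum of eigenvectors. *)
Fixpoint shiftprod (m n : nat) (v : V) : V :=
  if n is n'.+1 then shiftprod m.+1 n' (ap H v - (c * q ^+ m) *: v) else v.

Lemma shiftprod_lin m n a u v :
  shiftprod m n (a *: u + v) = a *: shiftprod m n u + shiftprod m n v.
Proof.
elim: n m u v => //= n IH m u v; rewrite -IH !ap_lin; congr shiftprod.
by lcomb F V ltac:(by ring).
Qed.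

Lemma shiftprod0 m n : shiftprod m n 0 = 0.
Proof. by have := shiftprod_lin m n (-1) 0 0; rewrite !scaleN1r !addNr. Qed.

Lemma shiftprodZ m n a v : shiftprod m n (a *: v) = a *: shiftprod m n v.
Proof. by rewrite -[a *: v]addr0 shiftprod_lin shiftprod0 addr0. Qed.

Lemma shiftprod_comm (f : endo V) m n v :
  (forall w, ap f (ap H w) = ap H (ap f w)) ->
  shiftprod m n (ap f v) = ap f (shiftprod m n v).
Proof.
move=> fH; elim: n m v => //= n IH m v.
by rewrite -IH !ap_lin fH.
Qed.

Lemma shiftprodS m n v :
  shiftprod m n.+1 v = ap H (shiftprod m n v) - (c * q ^+ (m + n)) *: shiftprod m n v.
Proof.
elim: n m v => [|n IH] m v; first by rewrite addn0.
by rewrite -[LHS]/(shiftprod m.+1 n.+1 _) IH addSnnS.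
Qed.

Lemma shiftprod_mono m n k v :
  (n <= k)%N -> shiftprod m n v = 0 -> shiftprod m k v = 0.
Proof.
move=> /subnK <-; elim: (k - n)%N => [//|r IH] h.
by rewrite addSn shiftprodS IH // ap_lin scaler0 subrr.
Qed.

(** Factor by factor, (H - c q^(k+1)) x_j = q x_j (H - c q^k). *)
Lemma shiftprodX m n j v :
  shiftprod m.+1 n (ap (x j) v) = q ^+ n *: ap (x j) (shiftprod m n v).
Proof.
elim: n m v => [|n IH] m v /=; first by rewrite expr0 scale1r.
have -> : ap H (ap (x j) v) - (c * q ^+ m.+1) *: ap (x j) v
    = q *: ap (x j) (ap H v - (c * q ^+ m) *: v).
  by rewrite HX !ap_lin exprS; lcomb F V ltac:(by ring).
by rewrite shiftprodZ IH scalerA exprS.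
Qed.

(* [v] is a sum of eigenvectors of H for eigenvalues c q^n with n > 0, that is,
   of vectors strictly below [zeta]. *)
Definition deep (v : V) : Prop := exists n, shiftprod 1 n v = 0.

Lemma deep0 : deep 0. Proof. by exists 0%N. Qed.

Lemma deep_lin a u v : deep u -> deep v -> deep (a *: u + v).
Proof.
move=> [n hn] [k hk]; exists (maxn n k); rewrite shiftprod_lin.
by rewrite (shiftprod_mono (leq_maxl _ _) hn) (shiftprod_mono (leq_maxr _ _) hk)
  scaler0 addr0.
Qed.

Lemma deepZ a v : deep v -> deep (a *: v).
Proof. by move=> h; rewrite -[_ *: _]addr0; apply: deep_lin => //; exact: deep0. Qed.

Lemma deep_comm (f : endo V) v :
  (forall w, ap f (ap H w) = ap H (ap f w)) -> deep v -> deep (ap f v).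
Proof. by move=> fH [n hn]; exists n; rewrite shiftprod_comm // hn ap_lin. Qed.

(** H - c kills [zeta], so the factors of indices 0 to n kill v; moved past x_j, they become those
    of indices 1 to n + 1. *)
Lemma deepX a j v : deep (v - a *: zeta) -> deep (ap (x j) v).
Proof.
move=> [n hn]; exists n.+1; rewrite shiftprodX.
have -> : shiftprod 0 n.+1 v = 0; last by rewrite ap_lin scaler0.
rewrite /= expr0 mulr1.
have -> : ap H v - c *: v = ap H (v - a *: zeta) - c *: (v - a *: zeta).
  by rewrite !ap_lin H_zeta; lcomb F V ltac:(by ring).
rewrite -(scaleNr c) -[ap H _]scale1r shiftprod_lin shiftprodZ shiftprod_comm //.
by rewrite hn ap_lin !scaler0 addr0.
Qed.

(** On [zeta] the factor of index n acts by c (1 - q^n), which is nonzero for n > 0 because q is not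
    a root of unity. *)
Lemma deep_zeta k : deep (k *: zeta) -> k = 0.
Proof.
move=> [n]; rewrite shiftprodZ.
have [b b0 ->] : exists2 b, b != 0 & shiftprod 1 n zeta = b *: zeta.
  elim: n => [|n [b b0 hb]]; first by exists 1; rewrite ?oner_neq0 // scale1r.
  exists (b * c * (1 - q ^+ n.+1)); last first.
    rewrite shiftprodS hb ap_lin H_zeta add1n.
    by lcomb F V ltac:(by ring).
  by rewrite !mulf_neq0 // subr_eq0 eq_sym q_root.
move=> /eqP; rewrite scalerA scaler_eq0 (negPf zeta0) orbF mulf_eq0 (negPf b0) orbF.
by move/eqP.
Qed.

End Depth.

(** * Serre relators skew-commute with the opposite generators *)

Section SerreComputations.
Variables (F : fieldType) (V : lmodType F).
Implicit Types (A B C Y k kV : endo V) (pA pC : bool) (a c Q : F) (v : V).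

(** Y is opposite to A. Moving it past the bracket leaves only, up to sign, c times the commutator
    of k - kV with C, which vanishes. *)
Lemma commutator_left pA pC A C Y k kV c :
  (forall v, ap A (ap Y v) = (-1) ^+ pA *: ap Y (ap A v) + c *: (ap k v - ap kV v)) ->
  (forall v, ap C (ap Y v) = (-1) ^+ (pC && pA) *: ap Y (ap C v)) ->
  (forall v, ap k (ap C v) = ap C (ap k v)) ->
  (forall v, ap kV (ap C v) = ap C (ap kV v)) ->
  scomm (sbracket 1 (pA, A) (pC, C)) (pA, Y).
Proof.
move=> AY CY kC kVC v.
case: pA AY CY => AY CY; case: pC CY => CY; rewrite /= ?expr0 ?expr1 in AY CY.
all: rewrite !apE /= ?expr0 ?expr1.
all: do ! rewrite ?ap_lin ?AY ?CY ?kC ?kVC.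
all: lcomb F V ltac:(by ring).
Qed.

Lemma commutator_right pA pC A C Y k kV c :
  (forall v, ap A (ap Y v) = (-1) ^+ (pA && pC) *: ap Y (ap A v)) ->
  (forall v, ap C (ap Y v) = (-1) ^+ pC *: ap Y (ap C v) + c *: (ap k v - ap kV v)) ->
  (forall v, ap k (ap A v) = ap A (ap k v)) ->
  (forall v, ap kV (ap A v) = ap A (ap kV v)) ->
  scomm (sbracket 1 (pA, A) (pC, C)) (pC, Y).
Proof.
move=> AY CY kA kVA v.
case: pA AY => AY; case: pC CY AY => CY AY; rewrite /= ?expr0 ?expr1 in AY CY.
all: rewrite !apE /= ?expr0 ?expr1.
all: do ! rewrite ?ap_lin ?AY ?CY ?kA ?kVA.
all: lcomb F V ltac:(by ring).
Qed.

Lemma square_comm B Y k kV c :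
  (forall v, ap B (ap Y v) = - ap Y (ap B v) + c *: (ap k v - ap kV v)) ->
  (forall v, ap k (ap B v) = ap B (ap k v)) ->
  (forall v, ap kV (ap B v) = ap B (ap kV v)) ->
  scomm (sbracket 1 (true, B) (true, B)) (true, Y).
Proof.
move=> BY kB kVB v; rewrite !apE /= ?expr0 ?expr1.
by do ! rewrite ?ap_lin ?BY ?kB ?kVB; lcomb F V ltac:(by ring).
Qed.

(** The relator expands to A A C - (Q + Q^-1) A C A + C A A, symmetric in Q and Q^-1. So both values
    of Q are allowed, and one computation serves x^+ (a = q_i) and x^- (a = q_i^-1). *)
Lemma serre3_inner pC A C Y k kV a c Q :
  a != 0 -> Q = a \/ Q = a^-1 ->
  (forall v, ap A (ap Y v) = ap Y (ap A v) + c *: (ap k v - ap kV v)) ->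
  (forall v, ap C (ap Y v) = ap Y (ap C v)) ->
  (forall v, ap k (ap A v) = (a * a) *: ap A (ap k v)) ->
  (forall v, ap kV (ap A v) = (a * a)^-1 *: ap A (ap kV v)) ->
  (forall v, ap k (ap C v) = a^-1 *: ap C (ap k v)) ->
  (forall v, ap kV (ap C v) = a *: ap C (ap kV v)) ->
  scomm (sbracket Q^-1 (false, A) (sbracket Q (false, A) (pC, C))) (false, Y).
Proof.
move=> a0 ha AY CY kA kVA kC kVC v; rewrite !apE /= andbF ?expr0.
do ! rewrite ?ap_lin ?AY ?CY ?kA ?kVA ?kC ?kVC.
by case: ha => ->; rewrite ?invrK; lcomb F V ltac:(by field).
Qed.

Lemma serre3_outer pC A C Y k kV a c Q :
  a != 0 -> Q = a \/ Q = a^-1 ->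
  (forall v, ap A (ap Y v) = ap Y (ap A v)) ->
  (forall v, ap C (ap Y v) = (-1) ^+ pC *: ap Y (ap C v) + c *: (ap k v - ap kV v)) ->
  (forall v, ap k (ap A v) = a^-1 *: ap A (ap k v)) ->
  (forall v, ap kV (ap A v) = a *: ap A (ap kV v)) ->
  scomm (sbracket Q^-1 (false, A) (sbracket Q (false, A) (pC, C))) (pC, Y).
Proof.
move=> a0 ha AY CY kA kVA v; rewrite !apE /= andbb.
do ! rewrite ?ap_lin ?AY ?CY ?kA ?kVA.
by case: ha => ->; rewrite ?invrK ?expr0; lcomb F V ltac:(by field).
Qed.

Section Serre4.
Variables (pA pC : bool) (A B C : endo V) (a Q : F).
Hypotheses (a0 : a != 0) (ha : Q = a \/ Q = a^-1).
Hypothesis BB : forall v, ap B (ap B v) = 0.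
Let U :=
  sbracket 1 (sbracket Q^-1 (sbracket Q (pA, A) (true, B)) (pC, C)) (true, B).

(** With A replaced by k or kV, one of the two dies in the inner q-bracket with B, and the other
    leaves multiples of B C B that cancel because B B = 0. *)
Lemma serre4_left Y k kV c :
  (forall v, ap A (ap Y v) = (-1) ^+ pA *: ap Y (ap A v) + c *: (ap k v - ap kV v)) ->
  (forall v, ap B (ap Y v) = (-1) ^+ pA *: ap Y (ap B v)) ->
  (forall v, ap C (ap Y v) = (-1) ^+ (pC && pA) *: ap Y (ap C v)) ->
  (forall v, ap k (ap B v) = a^-1 *: ap B (ap k v)) ->
  (forall v, ap kV (ap B v) = a *: ap B (ap kV v)) ->
  (forall v, ap k (ap C v) = ap C (ap k v)) ->
  (forall v, ap kV (ap C v) = ap C (ap kV v)) ->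
  scomm U (pA, Y).
Proof.
move=> AY BY CY kB kVB kC kVC v; rewrite /U.
case: (pA) AY BY CY => AY BY CY; case: (pC) CY => CY; rewrite /= ?expr0 ?expr1 in AY BY CY *.
all: rewrite !apE /= ?expr0 ?expr1.
all: do ! rewrite ?ap_lin ?AY ?CY ?BY ?kB ?kVB ?kC ?kVC ?BB.
all: case: ha => ->; rewrite ?invrK; lcomb F V ltac:(by field).
Qed.

Lemma serre4_right Y k kV c :
  (forall v, ap A (ap Y v) = (-1) ^+ (pA && pC) *: ap Y (ap A v)) ->
  (forall v, ap B (ap Y v) = (-1) ^+ pC *: ap Y (ap B v)) ->
  (forall v, ap C (ap Y v) = (-1) ^+ pC *: ap Y (ap C v) + c *: (ap k v - ap kV v)) ->
  (forall v, ap k (ap B v) = a *: ap B (ap k v)) ->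
  (forall v, ap kV (ap B v) = a^-1 *: ap B (ap kV v)) ->
  (forall v, ap k (ap A v) = ap A (ap k v)) ->
  (forall v, ap kV (ap A v) = ap A (ap kV v)) ->
  scomm U (pC, Y).
Proof.
move=> AY BY CY kB kVB kA kVA v; rewrite /U.
case: (pC) AY BY CY => AY BY CY; case: (pA) AY => AY; rewrite /= ?expr0 ?expr1 in AY BY CY *.
all: rewrite !apE /= ?expr0 ?expr1.
all: do ! rewrite ?ap_lin ?AY ?CY ?BY ?kB ?kVB ?kA ?kVA ?BB.
all: case: ha => ->; rewrite ?invrK; lcomb F V ltac:(by field).
Qed.

(** Y can meet either occurrence of B. The remaining words cancel only after A and C are reordered,
    so this relator presupposes the relation between x_{i-1} and x_{i+1}. *)
Lemma serre4_mid Y k kV c :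
  (forall v, ap A (ap Y v) = (-1) ^+ pA *: ap Y (ap A v)) ->
  (forall v, ap B (ap Y v) = - ap Y (ap B v) + c *: (ap k v - ap kV v)) ->
  (forall v, ap C (ap Y v) = (-1) ^+ pC *: ap Y (ap C v)) ->
  (forall v, ap k (ap A v) = a^-1 *: ap A (ap k v)) ->
  (forall v, ap kV (ap A v) = a *: ap A (ap kV v)) ->
  (forall v, ap k (ap B v) = ap B (ap k v)) ->
  (forall v, ap kV (ap B v) = ap B (ap kV v)) ->
  (forall v, ap k (ap C v) = a *: ap C (ap k v)) ->
  (forall v, ap kV (ap C v) = a^-1 *: ap C (ap kV v)) ->
  (forall v, ap C (ap A v) = (-1) ^+ (pC && pA) *: ap A (ap C v)) ->
  scomm U (true, Y).
Proof.
move=> AY BY CY kA kVA kB kVB kC kVC CA v; rewrite /U.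
case: (pA) AY CA => AY CA; case: (pC) CY CA => CY CA; rewrite /= ?expr0 ?expr1 in AY CY CA *.
all: rewrite !apE /= ?expr0 ?expr1.
all: do ! rewrite ?ap_lin ?AY ?CY ?BY ?kA ?kVA ?kB ?kVB ?kC ?kVC ?BB ?CA.
all: case: ha => ->; rewrite ?invrK; lcomb F V ltac:(by field).
Qed.

End Serre4.
End SerreComputations.

(** * Irreducible highest weight representations *)

Section PairSpan.
Variables (F : fieldType) (N : nat) (q : F) (s : N.-tuple bool) (lam : 'I_N -> F).
Hypothesis q0 : q != 0.
Variables (V W : lmodType F) (rho : Uq_ops N V) (tau : Uq_ops N W).
Variables (zeta : V) (w : W).

(* The graph, in V x W, of the correspondence sending each word in the lowering
   operators applied to [zeta] to the same word applied to [w]. *)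
Inductive nspan : V -> W -> Prop :=
  | nspan_base : nspan zeta w
  | nspan_lin a v v' u u' :
      nspan v u -> nspan v' u' -> nspan (a *: v + v') (a *: u + u')
  | nspan_lower j v u :
      nspan v u -> nspan (ap (rho (Xm j)) v) (ap (tau (Xm j)) u).

Lemma nspan0 : nspan 0 0.
Proof.
have h := nspan_lin (-1) nspan_base nspan_base.
by rewrite !scaleN1r !addNr in h.
Qed.

Lemma nspanZ a v u : nspan v u -> nspan (a *: v) (a *: u).
Proof.
by move=> h; rewrite -[a *: v]addr0 -[a *: u]addr0; apply: nspan_lin => //; exact: nspan0.
Qed.

Lemma nspanD v v' u u' : nspan v u -> nspan v' u' -> nspan (v + v') (u + u').
Proof. by move=> h h'; rewrite -[v]scale1r -[u]scale1r; exact: nspan_lin. Qed.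

Lemma nspanB v v' u u' : nspan v u -> nspan v' u' -> nspan (v - v') (u - u').
Proof.
by move=> h /(nspanZ (-1)); rewrite !scaleN1r; exact: nspanD.
Qed.

Hypotheses (core_rho : Uq_core q s rho) (core_tau : Uq_core q s tau).
Hypotheses (zeta0 : zeta != 0) (w0 : w != 0).
Hypotheses (K_zeta : forall a, ap (rho (K a)) zeta = lam a *: zeta).
Hypotheses (K_w : forall a, ap (tau (K a)) w = lam a *: w).
Hypotheses (X_zeta : forall j, ap (rho (Xp j)) zeta = 0).
Hypotheses (X_w : forall j, ap (tau (Xp j)) w = 0).

Lemma nspanK a v u : nspan v u -> nspan (ap (rho (K a)) v) (ap (tau (K a)) u).
Proof.
elim=> [|b v1 v2 u1 u2 _ h1 _ h2|j v1 u1 _ h1].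
- by rewrite K_zeta K_w; apply: nspanZ; exact: nspan_base.
- by rewrite !ap_lin; exact: nspan_lin.
- rewrite (KX core_rho a false) (KX core_tau a false).
  by apply: nspanZ; exact: nspan_lower.
Qed.

Lemma nspanKV a v u :
  nspan v u -> nspan (ap (rho (Kinv a)) v) (ap (tau (Kinv a)) u).
Proof.
elim=> [|b v1 v2 u1 u2 _ h1 _ h2|j v1 u1 _ h1].
- rewrite (Kinv_zeta core_rho zeta0 K_zeta) (Kinv_zeta core_tau w0 K_w).
  by apply: nspanZ; exact: nspan_base.
- by rewrite !ap_lin; exact: nspan_lin.
- rewrite (KVX q0 core_rho a false) (KVX q0 core_tau a false).
  by apply: nspanZ; exact: nspan_lower.
Qed.

Lemma nspan_kap f i v u :
  nspan v u -> nspan (ap (kap rho f i) v) (ap (kap tau f i) u).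
Proof.
by move=> h; rewrite /kap; case: f; rewrite !ap_mul;
  [apply: nspanK; apply: nspanKV | apply: nspanKV; apply: nspanK].
Qed.

(** x_i^+ is moved through the same lowering word in both modules at once; the torus terms that
    appear agree because [zeta] and [w] have the same weight. *)
Lemma nspan_raise i v u :
  nspan v u -> nspan (ap (rho (Xp i)) v) (ap (tau (Xp i)) u).
Proof.
elim=> [|b v1 v2 u1 u2 _ h1 _ h2|j v1 u1 h h1].
- by rewrite X_zeta X_w; exact: nspan0.
- by rewrite !ap_lin; exact: nspan_lin.
- rewrite (XX core_rho true) (XX core_tau true) /=.
  apply: nspan_lin; first exact: nspan_lower.
  case: eqP => _; last exact: nspan0.
  by apply: nspanZ; apply: nspanB; exact: nspan_kap.
Qed.

Lemma nspan_gen g v u : nspan v u -> nspan (ap (rho g) v) (ap (tau g) u).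
Proof.
case: g => j; [exact: nspan_raise|exact: nspan_lower|exact: nspanK|exact: nspanKV].
Qed.

Lemma nspan_total :
  (forall M : set V, subrep rho M -> M zeta -> M = setT) ->
  forall v, exists u, nspan v u.
Proof.
move=> gen; suff full : (fun v => exists u, nspan v u) = setT :> set V.
  by move=> v; have : [set: V]%classic v by []; rewrite -full.
apply: gen; last by exists w; exact: nspan_base.
split; first by exists 0; exact: nspan0.
- by move=> a u v' [x hx] [y hy]; exists (a *: x + y); exact: nspan_lin.
- by move=> g v' [x hx]; exists (ap (tau g) x); exact: nspan_gen.
Qed.

Variables (H : endo V) (H' : endo W) (c c' : F).
Hypotheses (H_zeta : ap H zeta = c *: zeta) (H'_w : ap H' w = c' *: w).
Hypothesis HX : forall j v,
  ap H (ap (rho (Xm j)) v) = q *: ap (rho (Xm j)) (ap H v).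
Hypothesis H'X : forall j v,
  ap H' (ap (tau (Xm j)) v) = q *: ap (tau (Xm j)) (ap H' v).

(** The point is the common k: paired vectors have the same coefficient on the maximal vectors, so 0
    cannot be paired with [w]. *)
Lemma nspan_deep v u : nspan v u ->
  exists k, deep q H c (v - k *: zeta) /\ deep q H' c' (u - k *: w).
Proof.
elim=> [|b v1 v2 u1 u2 _ [k1 [h1 h1']] _ [k2 [h2 h2']]|j v1 u1 _ [k [h h']]].
- by exists 1; rewrite !scale1r !subrr; split; exact: deep0.
- exists (b * k1 + k2); split.
    have -> : b *: v1 + v2 - (b * k1 + k2) *: zeta
        = b *: (v1 - k1 *: zeta) + (v2 - k2 *: zeta).
      by lcomb F V ltac:(by ring).
    exact: deep_lin.
  have -> : b *: u1 + u2 - (b * k1 + k2) *: w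
      = b *: (u1 - k1 *: w) + (u2 - k2 *: w).
    by lcomb F W ltac:(by ring).
  exact: deep_lin.
- exists 0; rewrite !scale0r !subr0; split.
    exact: (deepX H_zeta (x := fun j => rho (Xm j)) HX j h).
  exact: (deepX H'_w (x := fun j => tau (Xm j)) H'X j h').
Qed.

End PairSpan.

Section SerreRelations.
Variables (F : fieldType) (N : nat) (q : F) (s : N.-tuple bool) (lam : 'I_N -> F).
Hypotheses (q0 : q != 0) (q_root : forall k : nat, (0 < k)%N -> q ^+ k != 1).
Variables (V : lmodType F) (rho : Uq_ops N V) (zeta : V).
Hypotheses (core : Uq_core q s rho) (irr : irreducible_rep rho).
Hypothesis hw : highest_weight_rep lam rho zeta.

Let zeta0 : zeta != 0. Proof. by case: hw. Qed.
Let X_zeta j : ap (rho (Xp j)) zeta = 0. Proof. by case: hw => _ _ h _; exact: h. Qed.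
Let K_zeta a : ap (rho (K a)) zeta = lam a *: zeta. Proof. by case: hw => _ _ _ h; exact: h. Qed.

Let gen (M : set V) : subrep rho M -> M zeta -> M = setT.
Proof. by case: hw => _ h _ _; exact: h. Qed.

(** With both modules equal, the graph serves as an induction principle: every vector is a
    combination of lowering words applied to [zeta]. *)
Let nspan_ex v : exists u, nspan rho rho zeta zeta v u.
Proof.
exact: (nspan_total q0 core core zeta0 zeta0 K_zeta K_zeta X_zeta X_zeta gen).
Qed.

Section Vanishing.
Variable c : F.
Hypotheses (c0 : c != 0) (H_zeta : ap (height s rho) zeta = c *: zeta).

Let H := height s rho.
Let HX := heightX q0 core.

Lemma deep_lower j v : deep q H c (ap (rho (Xm j)) v).
Proof.
have [u huv] := nspan_ex v.
have [k [hk _]] := nspan_deep H_zeta H_zeta HX HX huv.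
exact: (deepX H_zeta (x := fun j => rho (Xm j)) HX j hk).
Qed.

(** The trace, on the module, of lying in the augmentation ideal of the algebra of the x^+ or of the
    x^-. Generators satisfy it and brackets preserve it, so every Serre relator does. *)
Definition augmented (e : bool) (f : endo V) : Prop :=
  if e then ap f zeta = 0 else forall v, deep q H c (ap f v).

Lemma augmented_gen e i : augmented e (rho (Xpm e i)).
Proof. by case: e => /=; [exact: X_zeta | exact: deep_lower]. Qed.

Lemma augmented_sbracket e a (X Y : bool * endo V) :
  augmented e X.2 -> augmented e Y.2 -> augmented e (sbracket a X Y).2.
Proof.
case: e => /= hX hY.
  by rewrite ap_sbracket hX hY !ap_lin scaler0 subrr.
move=> v; rewrite ap_sbracket addrC -scaleNr.
by apply: deep_lin.
Qed.

Definition raise_word (ws : seq 'I_N.-1) (v : V) : V :=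
  foldr (fun j => ap (rho (Xp j))) v ws.

Lemma raise_word_lin ws a u v :
  raise_word ws (a *: u + v) = a *: raise_word ws u + raise_word ws v.
Proof. by elim: ws => //= j ws ->; rewrite !ap_lin. Qed.

Lemma raise_word_scale ws a v : raise_word ws (a *: v) = a *: raise_word ws v.
Proof. by elim: ws => //= j ws ->; rewrite !ap_lin. Qed.

Lemma raise_word0 ws : raise_word ws 0 = 0.
Proof. by elim: ws => //= j ws ->; rewrite ap_lin. Qed.

(* The radical of the contravariant form, in disguise. *)
Let never_top v := forall ws, deep q H c (raise_word ws v).

Let never_topZ a v : never_top v -> never_top (a *: v).
Proof. by move=> h ws; rewrite raise_word_scale; apply: deepZ. Qed.

Let never_topD u v : never_top u -> never_top v -> never_top (u + v).
Proof.
by move=> hu hv ws; rewrite -[u]scale1r raise_word_lin; apply: deep_lin.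
Qed.

Let never_topK a v : never_top v -> never_top (ap (rho (K a)) v).
Proof.
move=> h ws; suff [b ->] : exists b, raise_word ws (ap (rho (K a)) v)
    = b *: ap (rho (K a)) (raise_word ws v).
  by apply: deepZ; apply: deep_comm => // x; exact: (heightK core).
elim: ws => [|j ws [b /= ->]]; first by exists 1; rewrite scale1r.
exists (b * (q ^ (form_ea s a j))^-1); rewrite (KX core a true j) /= expr0 mul1r.
rewrite ap_lin scalerA -mulrA mulVf ?mulr1 //; exact: expfz_neq0.
Qed.

Let never_topKV a v : never_top v -> never_top (ap (rho (Kinv a)) v).
Proof.
move=> h ws; suff [b ->] : exists b, raise_word ws (ap (rho (Kinv a)) v)
    = b *: ap (rho (Kinv a)) (raise_word ws v).
  by apply: deepZ; apply: deep_comm => // x; exact: (heightKV core).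
elim: ws => [|j ws [b /= ->]]; first by exists 1; rewrite scale1r.
exists (b * (q ^ (- form_ea s a j))^-1); rewrite (KVX q0 core a true j) /= expr0 mul1r.
rewrite ap_lin scalerA -mulrA mulVf ?mulr1 //; exact: expfz_neq0.
Qed.

Let never_top_kap f j v : never_top v -> never_top (ap (kap rho f j) v).
Proof.
by move=> h; rewrite /kap; case: f; rewrite !ap_mul;
  [apply: never_topK; apply: never_topKV | apply: never_topKV; apply: never_topK].
Qed.

Let never_top_raise j v : never_top v -> never_top (ap (rho (Xp j)) v).
Proof. by move=> h ws; have := h (rcons ws j); rewrite /raise_word foldr_rcons. Qed.

Let never_top_lower j v : never_top v -> never_top (ap (rho (Xm j)) v).
Proof.
(* The last letter of the word acts first. Exchanging x_k^+ with x_j^- leaves x_j^- on x_k^+ v,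
   covered by the shorter word, and a torus term. *)
move=> h ws; elim/last_ind: ws v h => [v _|ws k IH v h]; first exact: deep_lower.
rewrite /raise_word foldr_rcons -/(raise_word _ _) (XX core true) raise_word_lin.
apply: deep_lin; first by apply: IH; exact: never_top_raise.
case: eqP => _; last by rewrite raise_word0; exact: deep0.
rewrite raise_word_scale; apply: deepZ.
rewrite addrC -scaleN1r; move: ws {IH}.
by apply: never_topD; [apply: never_topZ|]; exact: never_top_kap.
Qed.

(** [never_top] is a subrepresentation, and a proper one: the empty word would make [zeta] itself
    deep. *)
Lemma never_top0 v : never_top v -> v = 0.
Proof.
case: irr => _ /(_ never_top) [].
- split; first by move=> ws; rewrite raise_word0; exact: deep0.
    by move=> a x y hx hy; apply: never_topD => //; exact: never_topZ.
  by case=> j x;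
    [exact: never_top_raise|exact: never_top_lower|exact: never_topK|exact: never_topKV].
- by move=> -> ->.
- move=> full; have : never_top zeta by rewrite full.
  move=> /(_ [::]) /=; rewrite -[zeta in deep _ _ _ zeta]scale1r.
  move=> /(deep_zeta q_root c0 zeta0 H_zeta) /eqP.
  by rewrite oner_eq0.
Qed.

(* For [e = true], U kills every word in the x^- applied to [zeta]; for
   [e = false], no word in the x^+ brings its image back to the top. *)
Lemma augmented_scomm0 e (U : bool * endo V) :
  augmented e U.2 -> (forall j, scomm U (homX s rho (~~ e) j)) -> U.2 = 0.
Proof.
move=> aug comm; apply: ap_ext => v; rewrite ap_zero; case: e aug comm => /= aug comm.
  have [u] := nspan_ex v; elim=> [//|b v1 v2 u1 u2 _ h1 _ h2|j v1 u1 _ h1].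
    by rewrite !ap_lin h1 h2 scaler0 addr0.
  by rewrite (comm j) /= h1 !ap_lin scaler0.
apply: never_top0 => ws.
suff [b ->] : exists b, raise_word ws (ap U.2 v) = b *: ap U.2 (raise_word ws v).
  exact: deepZ.
elim: ws => [|j ws [b /= ->]]; first by exists 1; rewrite scale1r.
have := scomm_sym (comm j) (raise_word ws v) => /= h.
by rewrite ap_lin h scalerA; eexists.
Qed.

End Vanishing.
End SerreRelations.

Section KappaWeights.
Variables (F : fieldType) (N : nat) (q : F) (s : N.-tuple bool).
Variables (V : lmodType F) (rho : Uq_ops N V).
Hypotheses (q0 : q != 0) (core : Uq_core q s rho).
Implicit Types (e : bool) (i j : 'I_N.-1) (v : V).

Definition wt e i j : F := q ^ ((-1) ^+ (~~ e) * form_aa s i j).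

Lemma wt_neq0 e i j : wt e i j != 0.
Proof. exact: expfz_neq0. Qed.

Lemma wtC e i j : wt e i j = wt e j i.
Proof. by rewrite /wt form_aaC. Qed.

Lemma wt1 e i j : form_aa s i j = 0 -> wt e i j = 1.
Proof. by rewrite /wt => ->; rewrite mulr0 expr0z. Qed.

Lemma wt_next e i j : j = i.+1 :> nat ->
  wt e i j = q ^ (- ((-1) ^+ (~~ e) * sgn s (node_r i))).
Proof. by move=> h; rewrite /wt form_aa_next // mulrN. Qed.

Lemma wt_prev e i j : i = j.+1 :> nat ->
  wt e i j = q ^ (- ((-1) ^+ (~~ e) * sgn s (node_l i))).
Proof. by move=> h; rewrite /wt form_aa_prev // mulrN. Qed.

Lemma kapT e i j v :
  ap (kap rho true i) (ap (rho (Xpm e j)) v)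
    = wt e i j *: ap (rho (Xpm e j)) (ap (kap rho true i) v).
Proof. by rewrite (kapX q0 core) expr0 mul1r. Qed.

Lemma kapF e i j v :
  ap (kap rho false i) (ap (rho (Xpm e j)) v)
    = (wt e i j)^-1 *: ap (rho (Xpm e j)) (ap (kap rho false i) v).
Proof. by rewrite (kapX q0 core) expr1 -mulrA mulN1r -invr_expz. Qed.

Lemma XX_neq e i j v : i != j ->
  ap (rho (Xpm e i)) (ap (rho (Xpm (~~ e) j)) v)
    = (-1) ^+ (node_parity s i && node_parity s j)
        *: ap (rho (Xpm (~~ e) j)) (ap (rho (Xpm e i)) v).
Proof. by move=> /negPf nij; rewrite (XX core) nij addr0. Qed.

Lemma XX_eq e i v :
  ap (rho (Xpm e i)) (ap (rho (Xpm (~~ e) i)) v)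
    = (-1) ^+ node_parity s i *: ap (rho (Xpm (~~ e) i)) (ap (rho (Xpm e i)) v)
      + xcoef q s e i *: (ap (kap rho true i) v - ap (kap rho false i) v).
Proof. by rewrite (XX core) eqxx andbb. Qed.

Lemma scomm_neq e i j : i != j -> scomm (homX s rho e i) (homX s rho (~~ e) j).
Proof. by move=> nij v; exact: XX_neq. Qed.

End KappaWeights.

(** * All defining relations from the core relations *)

Section UqRepOfCore.
Variables (F : fieldType) (N : nat) (q : F) (s : N.-tuple bool) (lam : 'I_N -> F).
Hypotheses (q0 : q != 0) (q_root : forall k : nat, (0 < k)%N -> q ^+ k != 1).
Hypothesis two0 : (2%:R : F) != 0.
Variables (V : lmodType F) (rho : Uq_ops N V) (zeta : V).
Hypotheses (core : Uq_core q s rho) (irr : irreducible_rep rho).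
Hypothesis hw : highest_weight_rep lam rho zeta.
Implicit Types (e : bool) (i j : 'I_N.-1) (v : V).

Let x e i := homX s rho e i.

Let augmented_word e (U : bool * endo V) :
  (forall c, ap (height s rho) zeta = c *: zeta ->
    augmented q s rho zeta c e U.2) ->
  (forall j, scomm U (x (~~ e) j)) -> U.2 = 0.
Proof.
case: hw => zeta0 _ _ K_zeta aug comm.
have [c c0 H_zeta] := height_zeta core zeta0 K_zeta.
exact: (augmented_scomm0 q0 q_root core irr hw c0 H_zeta (aug c H_zeta) comm).
Qed.

Let aug_x e i c : ap (height s rho) zeta = c *: zeta ->
  augmented q s rho zeta c e (x e i).2.
Proof. by move=> hc; exact: (augmented_gen q0 core hw hc). Qed.

(** The vanishing form makes kappa_i commute with x_j and kappa_j with x_i. For i = j the node is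
    odd and the relator is 2 x_i^2, treated apart since the opposite generator then meets both
    letters. *)
Lemma core_commute e i j : form_aa s i j = 0 -> (sbracket 1 (x e i) (x e j)).2 = 0.
Proof.
move=> fij; have w1 := wt1 q e fij; have w2 : wt q s e j i = 1 by rewrite wtC.
apply: (augmented_word (e := e)) => [c hc|l].
  by apply: augmented_sbracket; exact: aug_x.
have [<-|nil] := eqVneq i l.
  have [ij|nij] := eqVneq j i; last first.
    apply: (commutator_left (XX_eq core e i) (fun v => XX_neq core e v nij)).
      by move=> v; rewrite (kapT q0 core) w1 scale1r.
    by move=> v; rewrite (kapF q0 core) w1 invr1 scale1r.
  rewrite ij in fij w1 *.
  have p1 : node_parity s i by rewrite -form_aa_diag0 fij.
  have := @square_comm _ _ (rho (Xpm e i)) (rho (Xpm (~~ e) i)) _ _ _ _ _ _.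
  rewrite /x /homX p1; apply.
  - by move=> v; rewrite (XX_eq core) p1 expr1 scaleN1r.
  - by move=> v; rewrite (kapT q0 core) w1 scale1r.
  - by move=> v; rewrite (kapF q0 core) w1 invr1 scale1r.
have [jl|njl] := eqVneq j l; last by apply: scomm_sbracket; exact: (scomm_neq core).
rewrite -jl in nil *.
apply: (commutator_right (fun v => XX_neq core e v nil) (XX_eq core e j)).
  by move=> v; rewrite (kapT q0 core) w2 scale1r.
by move=> v; rewrite (kapF q0 core) w2 invr1 scale1r.
Qed.

Lemma core_serre3 e i j : form_aa s i i != 0 ->
  (j = i.+1 :> nat \/ i = j.+1 :> nat) ->
  let qi := q ^ sgn s (node_l i) in
  (sbracket qi^-1 (x e i) (sbracket qi (x e i) (x e j))).2 = 0.
Proof.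
rewrite form_aa_diag0 => /negPf pi adj qi.
have fij : form_aa s i j = - sgn s (node_l i).
  case: adj => h; last exact: form_aa_prev.
  by rewrite form_aa_next // sgn_parity pi expr0 mul1r.
(* a is q_i for x^+ and q_i^-1 for x^-, so kappa_i acts on x_i by a^2 and on its neighbour by a^-1
   in both cases. *)
pose a := q ^ ((-1) ^+ (~~ e) * sgn s (node_l i)).
have a0 : a != 0 by exact: expfz_neq0.
have qa : qi = a \/ qi = a^-1.
  rewrite /a /qi; case: (e); first by left; rewrite expr0 mul1r.
  by right; rewrite expr1 mulN1r -invr_expz invrK.
have wij : wt q s e i j = a^-1 by rewrite /wt fij mulrN -invr_expz.
have wii : wt q s e i i = a * a.
  by rewrite /wt form_aa_diag pi -expfzDr // mulr2n mulrDr.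
have nij : j != i by apply/eqP => ij; case: adj; rewrite ij; lia.
have xi : x e i = (false, rho (Xpm e i)) by rewrite /x /homX pi.
apply: (augmented_word (e := e)) => [c hc|l].
  by do ! apply: augmented_sbracket; exact: aug_x.
have [<-|nil] := eqVneq i l.
  have -> : x (~~ e) i = (false, rho (Xpm (~~ e) i)) by rewrite /x /homX pi.
  rewrite xi; apply: (serre3_inner (k := kap rho true i) (kV := kap rho false i)
    (c := xcoef q s e i) _ a0 qa).
  - by move=> v; rewrite (XX_eq core) pi expr0 scale1r.
  - by move=> v; rewrite (XX_neq core) // pi andbF expr0 scale1r.
  - by move=> v; rewrite (kapT q0 core) wii.
  - by move=> v; rewrite (kapF q0 core) wii.
  - by move=> v; rewrite (kapT q0 core) wij.
  - by move=> v; rewrite (kapF q0 core) wij invrK.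
have [<-|njl] := eqVneq j l; last by do ! apply: scomm_sbracket; exact: (scomm_neq core).
rewrite xi; apply: (serre3_outer a0 qa _ (XX_eq core e j)).
- by move=> v; rewrite (XX_neq core) 1?eq_sym // pi expr0 scale1r.
- by move=> v; rewrite (kapT q0 core) wtC wij.
- by move=> v; rewrite (kapF q0 core) wtC wij invrK.
Qed.

(** At the odd node q_{i+1} = q_i^-1, the shape required by the preceding computations. Two
    instances of [core_commute] are inputs: x_i^2 = 0, obtained by dividing by 2, and the relation
    between the two neighbours. *)
Lemma core_serre4 e (j i l : 'I_N.-1) : form_aa s i i = 0 ->
  i = j.+1 :> nat -> l = i.+1 :> nat ->
  let qi := q ^ sgn s (node_l i) in
  let qi1 := q ^ sgn s (node_r i) in
  (sbracket 1 (sbracket qi1 (sbracket qi (x e j) (x e i)) (x e l)) (x e i)).2 = 0.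
Proof.
move=> fii ij li qi qi1.
have pi : node_parity s i by rewrite -form_aa_diag0 fii.
have sr : sgn s (node_r i) = - sgn s (node_l i).
  by rewrite sgn_parity pi expr1 mulN1r.
pose a := q ^ ((-1) ^+ (~~ e) * sgn s (node_l i)).
have a0 : a != 0 by exact: expfz_neq0.
have qa : qi = a \/ qi = a^-1.
  rewrite /a /qi; case: (e); first by left; rewrite expr0 mul1r.
  by right; rewrite expr1 mulN1r -invr_expz invrK.
have q1 : qi1 = qi^-1 by rewrite /qi1 sr -invr_expz.
have wij : wt q s e i j = a^-1 by rewrite (wt_prev q s e ij) -invr_expz.
have wil : wt q s e i l = a by rewrite (wt_next q s e li) sr mulrN opprK.
have nij : i != j by apply/eqP => h; move: ij; rewrite h; lia.
have nil : i != l by apply/eqP => h; move: li; rewrite h; lia.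
have njl : j != l by apply/eqP => h; move: ij li; rewrite h; lia.
have fjl : form_aa s j l = 0 by apply: form_aa_far => //; lia.
have wii := wt1 q e fii; have wjl := wt1 q e fjl.
have wlj : wt q s e l j = 1 by rewrite wtC.
have xi : x e i = (true, rho (Xpm e i)) by rewrite /x /homX pi.
have BB v : ap (rho (Xpm e i)) (ap (rho (Xpm e i)) v) = 0.
  have /scommP/(_ v) := core_commute e fii; rewrite xi /= expr1 scaleN1r.
  move=> /eqP; rewrite -addr_eq0 -mulr2n -scaler_nat scaler_eq0 (negPf two0) /=.
  by move/eqP.
have CA v : ap (rho (Xpm e l)) (ap (rho (Xpm e j)) v)
    = (-1) ^+ (node_parity s l && node_parity s j)
        *: ap (rho (Xpm e j)) (ap (rho (Xpm e l)) v).
  by have /scommP := core_commute e (etrans (form_aaC s l j) fjl); apply.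
apply: (augmented_word (e := e)) => [c hc|k].
  by do ! apply: augmented_sbracket; exact: aug_x.
rewrite q1 xi.
have [<-|nik] := eqVneq i k.
  have -> : x (~~ e) i = (true, rho (Xpm (~~ e) i)) by rewrite /x /homX pi.
  apply: (serre4_mid (k := kap rho true i) (kV := kap rho false i)
    (c := xcoef q s e i) a0 qa BB).
  - by move=> v; rewrite (XX_neq core) 1?eq_sym // pi andbT.
  - by move=> v; rewrite (XX_eq core) pi expr1 scaleN1r.
  - by move=> v; rewrite (XX_neq core) 1?eq_sym // pi andbT.
  - by move=> v; rewrite (kapT q0 core) wij.
  - by move=> v; rewrite (kapF q0 core) wij invrK.
  - by move=> v; rewrite (kapT q0 core) wii scale1r.
  - by move=> v; rewrite (kapF q0 core) wii invr1 scale1r.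
  - by move=> v; rewrite (kapT q0 core) wil.
  - by move=> v; rewrite (kapF q0 core) wil.
  - exact: CA.
have [<-|njk] := eqVneq j k.
  apply: (serre4_left a0 qa BB (XX_eq core e j)).
  - by move=> v; rewrite (XX_neq core) // pi.
  - by move=> v; rewrite (XX_neq core) 1?eq_sym.
  - by move=> v; rewrite (kapT q0 core) wtC wij.
  - by move=> v; rewrite (kapF q0 core) wtC wij invrK.
  - by move=> v; rewrite (kapT q0 core) wjl scale1r.
  - by move=> v; rewrite (kapF q0 core) wjl invr1 scale1r.
have [<-|nlk] := eqVneq l k.
  apply: (serre4_right a0 qa BB _ _ (XX_eq core e l)).
  - by move=> v; rewrite (XX_neq core).
  - by move=> v; rewrite (XX_neq core) // pi.
  - by move=> v; rewrite (kapT q0 core) wtC wil.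
  - by move=> v; rewrite (kapF q0 core) wtC wil.
  - by move=> v; rewrite (kapT q0 core) wlj scale1r.
  - by move=> v; rewrite (kapF q0 core) wlj invr1 scale1r.
by rewrite -xi; do ! apply: scomm_sbracket; exact: (scomm_neq core).
Qed.

Lemma Uq_rep_of_core : Uq_rep q s rho.
Proof.
case: (core) => h1 h2 h3 h4 h5; split => //.
- exact: core_commute.
- exact: core_serre3.
- exact: core_serre4.
Qed.

End UqRepOfCore.

(** * Uniqueness of irreducible highest weight modules *)

Section Uniqueness.
Variables (F : fieldType) (N : nat) (q : F) (s : N.-tuple bool) (lam : 'I_N -> F).
Hypotheses (q0 : q != 0) (q_root : forall k : nat, (0 < k)%N -> q ^+ k != 1).

Lemma nspan_sym (V W : lmodType F) (rho : Uq_ops N V) (tau : Uq_ops N W) zeta w v u :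
  nspan rho tau zeta w v u -> nspan tau rho w zeta u v.
Proof.
elim=> [|a v1 v2 u1 u2 _ h1 _ h2|j v1 u1 _ h1].
- exact: nspan_base.
- exact: nspan_lin.
- exact: nspan_lower.
Qed.

(** The vectors paired with 0 form a subrepresentation of W. Were it all of W, 0 would be paired
    with [w]; the common coefficient k would then be 0 on the first side, making [w] deep. *)
Lemma nspan_functional (V W : lmodType F) (rho : Uq_ops N V) (tau : Uq_ops N W)
    zeta w u :
  Uq_core q s rho -> highest_weight_rep lam rho zeta ->
  Uq_core q s tau -> irreducible_rep tau -> highest_weight_rep lam tau w ->
  nspan rho tau zeta w 0 u -> u = 0.
Proof.
move=> core [zeta0 _ X_zeta K_zeta] core' [_ irr] [w0 _ X_w K_w].
have [c c0 H_zeta] := height_zeta core zeta0 K_zeta.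
have [c' c0' H_w] := height_zeta core' w0 K_w.
have gen := nspan_gen q0 core core' zeta0 w0 K_zeta K_w X_zeta X_w.
have [|h|full] := irr (fun u => nspan rho tau zeta w 0 u).
- split; first exact: nspan0.
    by move=> a x y hx hy; have := nspan_lin a hx hy; rewrite scaler0 addr0.
  by move=> g x hx; rewrite -(ap0 (rho g)); exact: gen.
- by move=> hu; have : [set 0]%classic u by rewrite -h.
- have : [set: W]%classic w by []; rewrite -full => h0.
  have [k [h1 h2]] := nspan_deep H_zeta H_w (heightX q0 core) (heightX q0 core') h0.
  have k0 : - k = 0.
    apply: (deep_zeta q_root c0 zeta0 H_zeta).
    by rewrite scaleNr -[- _]add0r.
  suff one : (1 : F) = 0 by have := oner_neq0 F; rewrite one eqxx.
  apply: (deep_zeta q_root c0' w0 H_w); move: h2.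
  by rewrite -scaleNr k0 scale0r addr0 scale1r.
Qed.

Lemma Virr_unique (V W : lmodType F) (rho : Uq_ops N V) (tau : Uq_ops N W) zeta w :
  Uq_core q s rho -> irreducible_rep rho -> highest_weight_rep lam rho zeta ->
  Uq_core q s tau -> irreducible_rep tau -> highest_weight_rep lam tau w ->
  exists phi : {linear V -> W},
    [/\ bijective phi, intertwines rho tau phi & phi zeta = w].
Proof.
move=> core irr hw core' irr' hw'.
have [zeta0 gen X_zeta K_zeta] := hw; have [w0 gen' X_w K_w] := hw'.
have tot := nspan_total q0 core core' zeta0 w0 K_zeta K_w X_zeta X_w gen.
have tot' := nspan_total q0 core' core w0 zeta0 K_w K_zeta X_w X_zeta gen'.
have ngen := nspan_gen q0 core core' zeta0 w0 K_zeta K_w X_zeta X_w.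
have funct v u u' :
    nspan rho tau zeta w v u -> nspan rho tau zeta w v u' -> u = u'.
  move=> h h'; have := nspanB h h'; rewrite subrr.
  by move=> /(nspan_functional core hw core' irr' hw') /eqP; rewrite subr_eq0 => /eqP.
have inj v v' u :
    nspan rho tau zeta w v u -> nspan rho tau zeta w v' u -> v = v'.
  move=> h h'; have := nspan_sym (nspanB h h'); rewrite subrr.
  by move=> /(nspan_functional core' hw' core irr hw) /eqP; rewrite subr_eq0 => /eqP.
(* The isomorphism sends v to its unique partner in the graph. Uniqueness of partners makes it
   linear and equivariant, and g inverts it. *)
have [f fP] := choice tot; have [g gP] := choice tot'.
have f_lin : linear f.
  by move=> a x y; apply: (funct (a *: x + y)); last exact: nspan_lin.
pose lf := GRing.isLinear.Build F V W *:%R f f_lin.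
pose phi : {linear V -> W} := HB.pack f lf.
exists phi; split.
- exists g => [v|u].
    by apply: (inj _ _ (f v)) => //; exact: nspan_sym.
  by apply: (funct (g u)) => //; exact: nspan_sym.
- move=> x v; apply: (funct (rho x v)); first exact: fP.
  exact: ngen.
- by apply: (funct zeta); [exact: fP | exact: nspan_base].
Qed.

End Uniqueness.

(** * The odd reflection *)

Section ReflectionComputations.
Variables (F : fieldType) (V : lmodType F).
Implicit Types v : V.

(* B, B' are x_i^+, x_i^- for the reflected node i, and A, A' those of a node j
   next to it; t = (-1)^|j| and Q = q^(alpha_i|alpha_j). Up to scalars, E and G
   below are the new x_j^+ and x_j^-, B kB and kB' B' the new x_i^- and x_i^+. *)
Section Neighbour.
Variables (t Q cA cB : F) (A B A' B' kA kB kA' kB' kAB kAB' : endo V).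
Hypotheses (t2 : t = 1 \/ t = -1) (Q0 : Q != 0).
Hypotheses (AA' : forall v, ap A (ap A' v) = t *: ap A' (ap A v) + cA *: (ap kA v - ap kA' v))
  (AB' : forall v, ap A (ap B' v) = t *: ap B' (ap A v))
  (BA' : forall v, ap B (ap A' v) = t *: ap A' (ap B v))
  (BB' : forall v, ap B (ap B' v) = - ap B' (ap B v) + cB *: (ap kB v - ap kB' v))
  (BB : forall v, ap B (ap B v) = 0)
  (B'B' : forall v, ap B' (ap B' v) = 0)
  (kB_A : forall v, ap kB (ap A v) = Q *: ap A (ap kB v))
  (kB_A' : forall v, ap kB (ap A' v) = Q^-1 *: ap A' (ap kB v))
  (kB'_A : forall v, ap kB' (ap A v) = Q^-1 *: ap A (ap kB' v))
  (kB'_A' : forall v, ap kB' (ap A' v) = Q *: ap A' (ap kB' v))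
  (kA_B : forall v, ap kA (ap B v) = Q *: ap B (ap kA v))
  (kA_B' : forall v, ap kA (ap B' v) = Q^-1 *: ap B' (ap kA v))
  (kA'_B : forall v, ap kA' (ap B v) = Q^-1 *: ap B (ap kA' v))
  (kA'_B' : forall v, ap kA' (ap B' v) = Q *: ap B' (ap kA' v))
  (kB_B : forall v, ap kB (ap B v) = ap B (ap kB v))
  (kB_B' : forall v, ap kB (ap B' v) = ap B' (ap kB v))
  (kB'_B : forall v, ap kB' (ap B v) = ap B (ap kB' v))
  (kB'_B' : forall v, ap kB' (ap B' v) = ap B' (ap kB' v))
  (kAkB : forall v, ap kA (ap kB v) = ap kAB v)
  (kBkA : forall v, ap kB (ap kA v) = ap kAB v)
  (kA'kB' : forall v, ap kA' (ap kB' v) = ap kAB' v)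
  (kB'kA' : forall v, ap kB' (ap kA' v) = ap kAB' v)
  (kB'kA : forall v, ap kB' (ap kA v) = ap kA (ap kB' v))
  (kBkA' : forall v, ap kB (ap kA' v) = ap kA' (ap kB v))
  (kBkB' : forall v, ap kB (ap kB' v) = v)
  (kB'kB : forall v, ap kB' (ap kB v) = v).
Let E : endo V := A * B - (t * Q) *: (B * A).
Let G : endo V := B' * A' - (t * Q^-1) *: (A' * B').

Ltac reorder :=
  rewrite /E /G !apE;
  do ! rewrite ?ap_lin ?AA' ?AB' ?BA' ?BB' ?BB ?B'B' ?kB_A ?kB_A' ?kB'_A ?kB'_A'
    ?kA_B ?kA_B' ?kA'_B ?kA'_B' ?kB_B ?kB_B' ?kB'_B ?kB'_B' ?kAkB ?kBkA ?kA'kB'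
    ?kB'kA' ?kB'kA ?kBkA' ?kBkB' ?kB'kB;
  lcomb F V ltac:(by case: t2 => ->; field).

Lemma neighbour_XpXm v :
  ap E (ap G v) + t *: ap G (ap E v)
    = (- (cA * cB * (Q - Q^-1))) *: (ap kAB v - ap kAB' v).
Proof. by reorder. Qed.

Lemma neighbour_Xm v : ap E (ap B (ap kB v)) + t *: ap B (ap kB (ap E v)) = 0.
Proof. by reorder. Qed.

Lemma neighbour_Xp v :
  ap kB' (ap B' (ap G v)) + t *: ap G (ap kB' (ap B' v)) = 0.
Proof. by reorder. Qed.

(** Bracketing E with the new x_i^+ recovers the old x_j^+: this inverts the formula that defines
    E. *)
Lemma neighbour_inv_p v :
  ap E (ap kB' (ap B' v)) + (t * Q) *: ap kB' (ap B' (ap E v))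
    = (- (cB * (Q ^+ 2 - 1))) *: ap A v.
Proof. by reorder. Qed.

Lemma neighbour_inv_m v :
  ap B (ap kB (ap G v)) + (t * Q^-1) *: ap G (ap B (ap kB v))
    = (- (cB * (1 - Q^-1 ^+ 2))) *: ap A' v.
Proof. by reorder. Qed.

End Neighbour.

(** A and C' belong to the two different neighbours of the odd node. The same Q occurs in E and G
    because alpha_i has opposite pairings with these neighbours. *)
Lemma neighbour_cross (pA pC : bool) (Q cB : F) (A B B' C' kB kB' : endo V) v :
  Q != 0 ->
  (forall v, ap A (ap B' v) = (-1) ^+ pA *: ap B' (ap A v)) ->
  (forall v, ap A (ap C' v) = (-1) ^+ (pA && pC) *: ap C' (ap A v)) ->
  (forall v, ap B (ap C' v) = (-1) ^+ pC *: ap C' (ap B v)) ->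
  (forall v, ap B (ap B' v) = - ap B' (ap B v) + cB *: (ap kB v - ap kB' v)) ->
  (forall v, ap kB (ap A v) = Q *: ap A (ap kB v)) ->
  (forall v, ap kB' (ap A v) = Q^-1 *: ap A (ap kB' v)) ->
  (forall v, ap kB (ap C' v) = Q *: ap C' (ap kB v)) ->
  (forall v, ap kB' (ap C' v) = Q^-1 *: ap C' (ap kB' v)) ->
  let E : endo V := A * B - ((-1) ^+ pA * Q) *: (B * A) in
  let G : endo V := B' * C' - ((-1) ^+ pC * Q) *: (C' * B') in
  ap E (ap G v) = (-1) ^+ (~~ pA && ~~ pC) *: ap G (ap E v).
Proof.
move=> Q0 AB' AC' BC' BB' kBA kB'A kBC' kB'C' /=.
case: pA AB' AC' => AB' AC'; case: pC AC' BC' => AC' BC';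
  rewrite /= ?expr0 ?expr1 in AB' AC' BC' *.
all: rewrite !apE.
all: do ! rewrite ?ap_lin ?AB' ?AC' ?BC' ?BB' ?kBA ?kB'A ?kBC' ?kB'C'.
all: lcomb F V ltac:(by field).
Qed.

End ReflectionComputations.

(** * Simple roots and parities after the swap *)

Section SwapForms.
Variables (N : nat) (s : N.-tuple bool) (i : 'I_N.-1).
Hypothesis odd_i : node_parity s i.
Implicit Types (a : 'I_N) (j : 'I_N.-1).

Let l := node_l i.
Let r := node_r i.
Let s' := swap_seq i s.

Lemma tnth_swap a : tnth s' a = tnth s (tperm l r a).
Proof. exact: tnth_mktuple. Qed.

Lemma sgn_swap a : sgn s' a = sgn s (tperm l r a).
Proof. by rewrite /sgn tnth_swap. Qed.

Lemma sgn_l : sgn s l = - sgn s r.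
Proof. by rewrite [in RHS]sgn_parity odd_i expr1 mulN1r opprK. Qed.

Lemma node_r_prev j : i = j.+1 :> nat -> node_r j = l.
Proof. by move=> h; apply: val_inj. Qed.

Lemma node_l_next j : j = i.+1 :> nat -> node_l j = r.
Proof. by move=> h; apply: val_inj. Qed.

Lemma tperm_node_l j : j != i -> j != i.+1 :> nat -> tperm l r (node_l j) = node_l j.
Proof.
rewrite -(inj_eq val_inj) /= => h1 h2; rewrite tpermD // -(inj_eq val_inj) /= eq_sym //.
Qed.

Lemma tperm_node_r j : j != i -> i != j.+1 :> nat -> tperm l r (node_r j) = node_r j.
Proof.
rewrite -(inj_eq val_inj) /= => h1 h2; rewrite tpermD // -(inj_eq val_inj) /=.
by rewrite eqSS eq_sym.
Qed.

(** After relabelling positions by the transposition, the simple roots of s' are -alpha_i, alpha_j +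
    alpha_i for j adjacent to i, and alpha_j otherwise; the next three lemmas read this off. *)
Lemma form_ea_swap a j :
  form_ea s' a j = sgn s (tperm l r a) *+ (tperm l r a == tperm l r (node_l j))
                 - sgn s (tperm l r a) *+ (tperm l r a == tperm l r (node_r j)).
Proof. by rewrite /form_ea /form_ee sgn_swap !(inj_eq perm_inj). Qed.

Lemma form_ea_swap_i a : form_ea s' a i = - form_ea s (tperm l r a) i.
Proof. by rewrite form_ea_swap tpermL tpermR opprB. Qed.

Lemma form_ea_swap_adj a j : (i == j.+1 :> nat) || (j == i.+1 :> nat) ->
  form_ea s' a j = form_ea s (tperm l r a) j + form_ea s (tperm l r a) i.
Proof.
rewrite form_ea_swap /form_ea /form_ee => /orP[/eqP h|/eqP h];
  have ji : j != i by [apply/eqP => e; move: h; rewrite e; lia].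
  have jn : j != i.+1 :> nat by rewrite h; lia.
  by rewrite (node_r_prev h) tpermL tperm_node_l // addrA subrK.
have ni : i != j.+1 :> nat by rewrite h; lia.
by rewrite (node_l_next h) tpermR tperm_node_r // [RHS]addrC addrA subrK.
Qed.

Lemma form_ea_swap_far a j : j != i -> i != j.+1 :> nat -> j != i.+1 :> nat ->
  form_ea s' a j = form_ea s (tperm l r a) j.
Proof.
by move=> h1 h2 h3; rewrite form_ea_swap tperm_node_l ?tperm_node_r.
Qed.

Lemma node_parity_swap_i : node_parity s' i.
Proof. by rewrite /node_parity !tnth_swap tpermL tpermR addbC. Qed.

Lemma node_parity_swap_adj j : (i == j.+1 :> nat) || (j == i.+1 :> nat) ->
  node_parity s' j = ~~ node_parity s j.
Proof.
rewrite /node_parity !tnth_swap => /orP[/eqP h|/eqP h];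
  have ji : j != i by [apply/eqP => e; move: h; rewrite e; lia].
  have jn : j != i.+1 :> nat by rewrite h; lia.
  rewrite (node_r_prev h) tpermL tperm_node_l //.
  by move: odd_i; rewrite /node_parity -/l -/r; do 3!case: (tnth s _).
have ni : i != j.+1 :> nat by rewrite h; lia.
rewrite (node_l_next h) tpermR tperm_node_r //.
by move: odd_i; rewrite /node_parity -/l -/r; do 3!case: (tnth s _).
Qed.

Lemma node_parity_swap_far j : j != i -> i != j.+1 :> nat -> j != i.+1 :> nat ->
  node_parity s' j = node_parity s j.
Proof.
by move=> h1 h2 h3; rewrite /node_parity !tnth_swap tperm_node_l ?tperm_node_r.
Qed.

End SwapForms.

(** * The reflected operators and their core relations *)

Section Reflection.
Variables (F : fieldType) (N : nat) (q : F) (s : N.-tuple bool).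
Variables (V : lmodType F) (rho : Uq_ops N V) (i : 'I_N.-1).
Hypotheses (q0 : q != 0) (q2 : q ^+ 2 != 1) (two0 : (2%:R : F) != 0).
Hypotheses (rep : Uq_rep q s rho) (odd_i : node_parity s i).
Implicit Types (e : bool) (a b : 'I_N) (j k : 'I_N.-1) (v : V).

Let l := node_l i.
Let r := node_r i.
Let d : int := sgn s r.
Let s' := swap_seq i s.
Let x e j := homX s rho e j.
Let p j := node_parity s j.

Lemma Uq_core_of_rep : Uq_core q s rho.
Proof. by case: rep => h1 h2 h3 h4 h5 _ _ _; split. Qed.
Let core := Uq_core_of_rep.

Definition adjacent_node j := (i == j.+1 :> nat) || (j == i.+1 :> nat).

(** Scalars forced by inverting beta, with d_i' = d and d_{i+1}' = -d. The extra (-1)^|j| at the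
    right neighbour appears because beta there takes its brackets in the other order. *)
Definition rcoef e j : F :=
  if j == i then (if e then d else - d)%:~R
  else if i == j.+1 :> nat then (if e then 1 else - d%:~R)
  else if j == i.+1 :> nat then
    - ((-1) ^+ p j * (if e then 1 else d%:~R))
  else 1.

(** The reflected generators without scalars. Skew-commutation is insensitive to scalars, so
    off-diagonal relations are checked on [rbase]. *)
Definition rbase e j : bool * endo V :=
  if j == i then
    (true, if e then kap rho false i * rho (Xm i) else rho (Xp i) * kap rho true i)
  else if adjacent_node j then
    (if e then sbracket (wt q s true i j) (x true j) (x true i)
     else sbracket (wt q s true i j)^-1 (x false i) (x false j))
  else x e j.

Definition ksign a : F :=
  if a == l then - d%:~R else if a == r then d%:~R else 1.

(* The operators by which the generators of U_q(g_s') act through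
   beta_{i,s}^{-1}: solving the formulas of beta_{i,s} for the generators of
   U_q(g_s') next to node i gives q-brackets of those of U_q(g_s). *)
Definition reflected : Uq_ops N V := fun g =>
  match g with
  | Xp j => rcoef true j *: (rbase true j).2
  | Xm j => rcoef false j *: (rbase false j).2
  | K a => ksign a *: rho (K (tperm l r a))
  | Kinv a => ksign a *: rho (Kinv (tperm l r a))
  end.

Lemma reflectedX e j : reflected (Xpm e j) = rcoef e j *: (rbase e j).2.
Proof. by case: e. Qed.

Lemma rbase_i e :
  rbase e i = (true, if e then kap rho false i * rho (Xm i)
                     else rho (Xp i) * kap rho true i).
Proof. by rewrite /rbase eqxx. Qed.

Lemma adjacent_neq j : adjacent_node j -> j != i.
Proof.
by case/orP => /eqP h; apply/eqP => e; move: h; rewrite e; lia.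
Qed.

Lemma rbase_adj e j : adjacent_node j ->
  rbase e j = if e then sbracket (wt q s true i j) (x true j) (x true i)
              else sbracket (wt q s true i j)^-1 (x false i) (x false j).
Proof. by move=> h; rewrite /rbase h (negPf (adjacent_neq h)). Qed.

Lemma rbase_far e j : j != i -> ~~ adjacent_node j -> rbase e j = x e j.
Proof. by rewrite /rbase => /negPf -> /negPf ->. Qed.

Lemma rbase_parity e j : (rbase e j).1 = node_parity s' j.
Proof.
have [->|ji] := eqVneq j i; first by rewrite rbase_i node_parity_swap_i.
case: (boolP (adjacent_node j)) => adj.
  rewrite rbase_adj // (node_parity_swap_adj odd_i adj).
  by case: e => /=; rewrite odd_i ?addbT.
rewrite rbase_far //; move: adj; rewrite negb_or => /andP[h1 h2].
by rewrite node_parity_swap_far.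
Qed.

Lemma homX_reflected e j :
  homX s' reflected e j = ((rbase e j).1, rcoef e j *: (rbase e j).2).
Proof. by rewrite /homX reflectedX rbase_parity. Qed.

Let Q := q ^ d.
Let D : F := d%:~R.

Lemma D_sq : D * D = 1.
Proof. by rewrite /D /d; case: (sgnP s r) => ->; rewrite ?rmorphN1 ?mulrNN mulr1. Qed.

Lemma Q_neq0 : Q != 0. Proof. exact: expfz_neq0. Qed.

Lemma Q_sq : Q ^+ 2 - 1 != 0.
Proof.
rewrite subr_eq0 /Q /d; case: (sgnP s r) => ->; first by rewrite expr1z.
by rewrite -invr_expz expr1z exprVn invr_eq1.
Qed.

Lemma QQ_neq0 : Q - Q^-1 != 0.
Proof.
have := Q_sq; apply: contra_neq => h.
by rewrite expr2 -[X in _ - X](divff Q_neq0) -mulrBr h mulr0.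
Qed.

Lemma xcoef_i : xcoef q s true i = - (Q - Q^-1)^-1.
Proof. by rewrite /xcoef (sgn_l odd_i) /Q -invr_expz invrK -invrN opprB. Qed.

Lemma wt_i e : wt q s e i i = 1.
Proof. by rewrite wt1 //; apply/eqP; rewrite form_aa_diag0. Qed.

Lemma wtN j k : wt q s false j k = (wt q s true j k)^-1.
Proof. by rewrite /wt expr1 expr0 mul1r mulN1r invr_expz. Qed.

Lemma X_sq e v : ap (rho (Xpm e i)) (ap (rho (Xpm e i)) v) = 0.
Proof.
have fii : form_aa s i i = 0 by apply/eqP; rewrite form_aa_diag0.
have /scommP/(_ v) := Uq_XX rep e fii; rewrite /= odd_i expr1 scaleN1r.
move=> /eqP; rewrite -addr_eq0 -mulr2n -scaler_nat scaler_eq0 (negPf two0) /=.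
by move/eqP.
Qed.

Definition tor f a : endo V := if f then rho (K a) else rho (Kinv a).

Lemma torC f g a b v : ap (tor f a) (ap (tor g b) v) = ap (tor g b) (ap (tor f a) v).
Proof.
case: f; case: g.
- exact: (KKC core).
- exact: (KKVC core).
- by rewrite (KKVC core).
- exact: (KVKVC core).
Qed.

Lemma kap_tor f j v : ap (kap rho f j) v = ap (tor f (node_l j)) (ap (tor (~~ f) (node_r j)) v).
Proof. by case: f; rewrite /kap ap_mul. Qed.

Lemma kap_torC f j v :
  ap (tor f (node_r j)) (ap (tor (~~ f) (node_l j)) v) = ap (kap rho (~~ f) j) v.
Proof. by rewrite torC kap_tor negbK. Qed.

Lemma kapC f g j k v :
  ap (kap rho f j) (ap (kap rho g k) v) = ap (kap rho g k) (ap (kap rho f j) v).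
Proof.
rewrite !kap_tor (torC (~~ f) g) (torC f g) [X in ap _ (ap _ X)](torC (~~ f) (~~ g)).
by rewrite [X in ap _ X](torC f (~~ g)).
Qed.

Lemma kapKT j v : ap (kap rho true j) (ap (kap rho false j) v) = v.
Proof. exact: (kapK core true). Qed.

Lemma kapKF j v : ap (kap rho false j) (ap (kap rho true j) v) = v.
Proof. exact: (kapK core false). Qed.

Lemma torK f a v : ap (tor (~~ f) a) (ap (tor f a) v) = v.
Proof. by case: f; [exact: (KVK core) | exact: (KKV core)]. Qed.

(** The position shared by nodes j and i cancels, leaving, up to sign, the torus element of node j
    after the swap. *)
Lemma kap_prev f j v : i = j.+1 :> nat ->
  ap (kap rho f j) (ap (kap rho f i) v)
    = ap (tor f (node_l j)) (ap (tor (~~ f) r) v).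
Proof. by move=> h; rewrite !kap_tor (node_r_prev h) torK. Qed.

Lemma kap_next f j v : j = i.+1 :> nat ->
  ap (kap rho f j) (ap (kap rho f i) v)
    = ap (tor f l) (ap (tor (~~ f) (node_r j)) v).
Proof. by move=> h; rewrite kapC !kap_tor (node_l_next h) torK. Qed.

Section Adjacent.
Variable j : 'I_N.-1.
Hypothesis adj : adjacent_node j.

Let ji : j != i. Proof. exact: adjacent_neq. Qed.
Let ij : i != j. Proof. by rewrite eq_sym. Qed.
Let t : F := (-1) ^+ p j.
Let Qj := wt q s true i j.
Let kABT := kap rho true j * kap rho true i.
Let kABF := kap rho false j * kap rho false i.
Let E := (sbracket Qj (x true j) (x true i)).2.
Let G := (sbracket Qj^-1 (x false i) (x false j)).2.

Let t2 : t = 1 \/ t = -1.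
Proof. by rewrite /t; case: (p j); [right|left]. Qed.
Let Qj0 : Qj != 0. Proof. exact: wt_neq0. Qed.

Let AA' v : ap (rho (Xp j)) (ap (rho (Xm j)) v) = t *: ap (rho (Xm j)) (ap (rho (Xp j)) v)
  + xcoef q s true j *: (ap (kap rho true j) v - ap (kap rho false j) v).
Proof. exact: (XX_eq core true). Qed.
Let AB' v : ap (rho (Xp j)) (ap (rho (Xm i)) v) = t *: ap (rho (Xm i)) (ap (rho (Xp j)) v).
Proof. by rewrite (XX_neq core true) // odd_i andbT. Qed.
Let BA' v : ap (rho (Xp i)) (ap (rho (Xm j)) v) = t *: ap (rho (Xm j)) (ap (rho (Xp i)) v).
Proof. by rewrite (XX_neq core true) // odd_i. Qed.
Let BB' v : ap (rho (Xp i)) (ap (rho (Xm i)) v) = - ap (rho (Xm i)) (ap (rho (Xp i)) v)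
  + xcoef q s true i *: (ap (kap rho true i) v - ap (kap rho false i) v).
Proof. by rewrite (XX_eq core true) odd_i expr1 scaleN1r. Qed.
Let kB_A v : ap (kap rho true i) (ap (rho (Xp j)) v) = Qj *: ap (rho (Xp j)) (ap (kap rho true i) v).
Proof. exact: (kapT q0 core true). Qed.
Let kB_A' v : ap (kap rho true i) (ap (rho (Xm j)) v) = Qj^-1 *: ap (rho (Xm j)) (ap (kap rho true i) v).
Proof. by rewrite (kapT q0 core false) wtN. Qed.
Let kB'_A v : ap (kap rho false i) (ap (rho (Xp j)) v) = Qj^-1 *: ap (rho (Xp j)) (ap (kap rho false i) v).
Proof. exact: (kapF q0 core true). Qed.
Let kB'_A' v : ap (kap rho false i) (ap (rho (Xm j)) v) = Qj *: ap (rho (Xm j)) (ap (kap rho false i) v).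
Proof. by rewrite (kapF q0 core false) wtN invrK. Qed.
Let kA_B v : ap (kap rho true j) (ap (rho (Xp i)) v) = Qj *: ap (rho (Xp i)) (ap (kap rho true j) v).
Proof. by rewrite (kapT q0 core true) wtC. Qed.
Let kA_B' v : ap (kap rho true j) (ap (rho (Xm i)) v) = Qj^-1 *: ap (rho (Xm i)) (ap (kap rho true j) v).
Proof. by rewrite (kapT q0 core false) wtN wtC. Qed.
Let kA'_B v : ap (kap rho false j) (ap (rho (Xp i)) v) = Qj^-1 *: ap (rho (Xp i)) (ap (kap rho false j) v).
Proof. by rewrite (kapF q0 core true) wtC. Qed.
Let kA'_B' v : ap (kap rho false j) (ap (rho (Xm i)) v) = Qj *: ap (rho (Xm i)) (ap (kap rho false j) v).
Proof. by rewrite (kapF q0 core false) wtN invrK wtC. Qed.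
Let kB_B v : ap (kap rho true i) (ap (rho (Xp i)) v) = ap (rho (Xp i)) (ap (kap rho true i) v).
Proof. by rewrite (kapT q0 core true) wt_i scale1r. Qed.
Let kB_B' v : ap (kap rho true i) (ap (rho (Xm i)) v) = ap (rho (Xm i)) (ap (kap rho true i) v).
Proof. by rewrite (kapT q0 core false) wt_i scale1r. Qed.
Let kB'_B v : ap (kap rho false i) (ap (rho (Xp i)) v) = ap (rho (Xp i)) (ap (kap rho false i) v).
Proof. by rewrite (kapF q0 core true) wt_i invr1 scale1r. Qed.
Let kB'_B' v : ap (kap rho false i) (ap (rho (Xm i)) v) = ap (rho (Xm i)) (ap (kap rho false i) v).
Proof. by rewrite (kapF q0 core false) wt_i invr1 scale1r. Qed.
Let BB := X_sq true.
Let B'B' := X_sq false.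

Let EE v : ap E v = ap (rho (Xp j) * rho (Xp i) - (t * Qj) *: (rho (Xp i) * rho (Xp j))) v.
Proof. by rewrite /E !apE /= odd_i andbT. Qed.
Let GE v : ap G v = ap (rho (Xm i) * rho (Xm j) - (t * Qj^-1) *: (rho (Xm j) * rho (Xm i))) v.
Proof. by rewrite /G !apE /= odd_i. Qed.

Lemma adjacent_XpXm v :
  ap E (ap G v) + t *: ap G (ap E v)
    = (- (xcoef q s true j * xcoef q s true i * (Qj - Qj^-1)))
        *: (ap kABT v - ap kABF v).
Proof.
rewrite !EE !GE.
apply: (neighbour_XpXm t2 Qj0 AA' AB' BA' BB' kB_A kB_A' kB'_A kB'_A' kA_B kA_B'
  kA'_B kA'_B').
all: by move=> w; first [exact: kapC | by []].
Qed.

Let signN : (-1) ^+ ((p j (+) p i) && true) = - t.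
Proof. by rewrite /t /p odd_i andbT addbT signrN. Qed.

Lemma scomm_adjacent_i : scomm (rbase true j) (rbase false i).
Proof.
move=> v; rewrite rbase_i rbase_adj //= signN -/E !ap_mul !EE.
by apply/eqP; rewrite scaleNr -addr_eq0 (neighbour_Xm t2 BB kB_A kB_B).
Qed.

Lemma scomm_i_adjacent : scomm (rbase true i) (rbase false j).
Proof.
move=> v; rewrite rbase_i rbase_adj //= [p i (+) _]addbC -[p j (+) _]andbT signN.
rewrite -/G !ap_mul !GE.
by apply/eqP; rewrite scaleNr -addr_eq0 (neighbour_Xp t2 Qj0 B'B' kB'_A' kB'_B').
Qed.

Lemma adjacent_inv_p v :
  ap E (ap (kap rho false i * rho (Xm i)) v)
    + (t * Qj) *: ap (kap rho false i * rho (Xm i)) (ap E v)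
    = (- (xcoef q s true i * (Qj ^+ 2 - 1))) *: ap (rho (Xp j)) v.
Proof.
rewrite !ap_mul !EE.
exact: (neighbour_inv_p t2 Qj0 AB' BB' kB_A kB'_A kB'_B kB'_B' (kapKT i)).
Qed.

Lemma adjacent_inv_m v :
  ap (rho (Xp i) * kap rho true i) (ap G v)
    + (t * Qj^-1) *: ap G (ap (rho (Xp i) * kap rho true i) v)
    = (- (xcoef q s true i * (1 - Qj^-1 ^+ 2))) *: ap (rho (Xm j)) v.
Proof.
rewrite !ap_mul !GE.
exact: (neighbour_inv_m t2 Qj0 BA' BB' kB_A' kB'_A' kB_B' (kapKF i)).
Qed.

End Adjacent.

Lemma wt_prev_i j : i = j.+1 :> nat -> wt q s true i j = Q.
Proof. by move=> h; rewrite wt_prev // expr0 mul1r (sgn_l odd_i) opprK. Qed.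

Lemma wt_next_i j : j = i.+1 :> nat -> wt q s true i j = Q^-1.
Proof. by move=> h; rewrite wt_next // expr0 mul1r invr_expz. Qed.

Lemma adjacentP j : adjacent_node j -> i = j.+1 :> nat \/ j = i.+1 :> nat.
Proof. by case/orP => /eqP; [left|right]. Qed.

(** j and k lie on opposite sides of the odd node i, where the two ends carry opposite signs; hence
    their weights against kappa_i are inverse. *)
Lemma scomm_adjacent2 j k : adjacent_node j -> adjacent_node k -> j != k ->
  scomm (rbase true j) (rbase false k).
Proof.
move=> aj ak jk; have [ji ki] := (adjacent_neq aj, adjacent_neq ak).
have wk : wt q s true i k = (wt q s true i j)^-1.
  have [hj|hj] := adjacentP aj; have [hk|hk] := adjacentP ak.
  - by move: jk; rewrite -(inj_eq val_inj) /= -eqSS -hj -hk eqxx.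
  - by rewrite (wt_prev_i hj) (wt_next_i hk).
  - by rewrite (wt_prev_i hk) (wt_next_i hj) invrK.
  - by move: jk; rewrite -(inj_eq val_inj) /= hj hk eqxx.
have /= h := neighbour_cross (pA := p j) (pC := p k) (cB := xcoef q s true i)
  (kB := kap rho true i) (kB' := kap rho false i) (A := rho (Xp j)) (B := rho (Xp i))
  (B' := rho (Xm i)) (C' := rho (Xm k)) _ (wt_neq0 s q0 true i j).
move=> v; rewrite !rbase_adj // wk invrK.
have -> : (sbracket (wt q s true i j) (x true j) (x true i)).1
    && (sbracket (wt q s true i j) (x false i) (x false k)).1
  = ~~ p j && ~~ p k by rewrite /= odd_i addbT.
have -> : (sbracket (wt q s true i j) (x true j) (x true i)).2
  = rho (Xp j) * rho (Xp i) - ((-1) ^+ p j * wt q s true i j) *: (rho (Xp i) * rho (Xp j)).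
  by rewrite /sbracket /= odd_i andbT.
have -> : (sbracket (wt q s true i j) (x false i) (x false k)).2
  = rho (Xm i) * rho (Xm k) - ((-1) ^+ p k * wt q s true i j) *: (rho (Xm k) * rho (Xm i)).
  by rewrite /sbracket /= odd_i.
apply: h => w.
- by rewrite (XX_neq core true) // odd_i andbT.
- by rewrite (XX_neq core true).
- by rewrite (XX_neq core true) 1?eq_sym // odd_i.
- by rewrite (XX_eq core true) odd_i expr1 scaleN1r.
- by rewrite (kapT q0 core true).
- by rewrite (kapF q0 core true).
- by rewrite (kapT q0 core false) wtN wk invrK.
- by rewrite (kapF q0 core false) wtN wk invrK.
Qed.

Lemma form_far j : j != i -> ~~ adjacent_node j -> form_aa s i j = 0.
Proof. by move=> ji; rewrite negb_or => /andP[h1 h2]; apply: form_aa_far => //; rewrite eq_sym. Qed.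

(** The reflection exchanges x_i^+ and x_i^- up to the torus, so this mixed relation is an old
    relation between generators of the same kind; the core relations of [rho] would not give it. *)
Lemma scomm_i_far e j : j != i -> ~~ adjacent_node j -> scomm (rbase e i) (rbase (~~ e) j).
Proof.
move=> ji jn; have fij := form_far ji jn.
rewrite rbase_i rbase_far // => v.
have w e' : wt q s e' i j = 1 by rewrite wt1.
case: e => /=; rewrite [LHS]ap_mul [X in _ *: ap _ X]ap_mul.
  have /scommP/(_ v) := Uq_XX rep false fij; rewrite /= odd_i => ->.
  by rewrite ap_lin (kapF q0 core false) w // invr1 scale1r.
rewrite (kapT q0 core true) w // scale1r.
have /scommP/(_ (ap (kap rho true i) v)) := Uq_XX rep true fij.
by rewrite /= odd_i => ->.
Qed.

Lemma scomm_adjacent_far e j k : adjacent_node j -> k != i -> ~~ adjacent_node k ->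
  scomm (rbase e j) (rbase (~~ e) k).
Proof.
move=> aj ki kn; have jk : j != k by apply: contraNneq kn => <-.
rewrite rbase_adj // rbase_far //.
by case: e; apply: scomm_sbracket; apply: (scomm_neq core) => //; rewrite eq_sym.
Qed.

Lemma rbase_scomm j k : j != k -> scomm (rbase true j) (rbase false k).
Proof.
move=> jk; have [ji|ji] := eqVneq j i.
  rewrite ji in jk *; rewrite eq_sym in jk.
  have [ak|nk] := boolP (adjacent_node k); first exact: scomm_i_adjacent.
  exact: scomm_i_far.
have [ki|ki] := eqVneq k i.
  rewrite ki.
  have [aj|nj] := boolP (adjacent_node j); first exact: scomm_adjacent_i.
  by apply: scomm_sym; exact: scomm_i_far.
have [ak|nk] := boolP (adjacent_node k); have [aj|nj] := boolP (adjacent_node j).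
- exact: scomm_adjacent2.
- by apply: scomm_sym; exact: scomm_adjacent_far.
- exact: scomm_adjacent_far.
- by rewrite !rbase_far //; exact: (scomm_neq core).
Qed.
Lemma ksign_l : ksign l = - D.
Proof. by rewrite /ksign eqxx. Qed.

Lemma ksign_r : ksign r = D.
Proof. by rewrite /ksign eq_sym (negPf (node_lr i)) eqxx. Qed.

Lemma ksign_node_l j : j != i -> j != i.+1 :> nat -> ksign (node_l j) = 1.
Proof.
by rewrite /ksign -!(inj_eq val_inj) /= => /negPf -> /negPf ->.
Qed.

Lemma ksign_node_r j : j != i -> i != j.+1 :> nat -> ksign (node_r j) = 1.
Proof.
by rewrite /ksign -!(inj_eq val_inj) /= eqSS eq_sym => /negPf -> /negPf; rewrite eq_sym => ->.
Qed.

Let DP : D = 1 \/ D = -1.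
Proof. by rewrite /D /d; case: (sgnP s r) => ->; [left|right; rewrite rmorphN1]. Qed.

Lemma ksignP a : ksign a = 1 \/ ksign a = -1.
Proof.
rewrite /ksign -/D; case: DP => ->; rewrite ?opprK.
  by do 2?[case: eqP => _]; [right|left|left].
by do 2?[case: eqP => _]; [left|right|left].
Qed.

Lemma ksign_sq a : ksign a * ksign a = 1.
Proof. by case: (ksignP a) => ->; rewrite ?mulrNN mulr1. Qed.

Lemma bracket_reflected j v :
  ap (sbracket 1 (homX s' reflected true j) (homX s' reflected false j)).2 v
    = (rcoef true j * rcoef false j)
        *: (ap (rbase true j).2 (ap (rbase false j).2 v)
            - (-1) ^+ node_parity s' j *: ap (rbase false j).2 (ap (rbase true j).2 v)).
Proof.
rewrite !homX_reflected ap_sbracket /= !rbase_parity andbb !ap_scale !ap_lin mulr1.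
by lcomb F V ltac:(by ring).
Qed.

Lemma reflected_kap f j v :
  ap (kap reflected f j) v
    = (ksign (node_l j) * ksign (node_r j))
        *: ap (tor f (tperm l r (node_l j))) (ap (tor (~~ f) (tperm l r (node_r j))) v).
Proof. by rewrite /kap; case: f; rewrite ap_mul !ap_scale ap_lin scalerA. Qed.

Lemma reflected_XpXm_i v :
  ap (sbracket 1 (homX s' reflected true i) (homX s' reflected false i)).2 v
    = (Q - Q^-1)^-1 *: (ap (kap reflected true i) v - ap (kap reflected false i) v).
Proof.
rewrite bracket_reflected (node_parity_swap_i odd_i) !rbase_i /rcoef eqxx.
rewrite !reflected_kap tpermL tpermR ksign_l ksign_r.
rewrite (kap_torC true) (kap_torC false).
rewrite [X in ap X (ap _ v)]/= [X in ap _ (ap X v)]/= /=.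
rewrite [ap (kap _ _ _ * _) (ap _ _)]ap_mul [ap (rho (Xp i) * _) v]ap_mul.
rewrite [ap (rho (Xp i) * _) (ap _ _)]ap_mul [ap (kap _ _ _ * _) v]ap_mul.
rewrite (kapF q0 core false) wt_i invr1 scale1r (kapF q0 core true) wt_i invr1 scale1r.
rewrite kapKF kapKT (XX_eq core true) odd_i xcoef_i. 
rewrite rmorphN mulrN -/D !mulNr !D_sq /= expr1.
by lcomb F V ltac:(by ring).
Qed.

Lemma reflected_XpXm j k :
  (sbracket 1 (homX s' reflected true j) (homX s' reflected false k)).2
    = if j == k then
        (q ^ sgn s' (node_l j) - (q ^ sgn s' (node_l j))^-1)^-1
          *: (kap reflected true j - kap reflected false j)
      else 0.
Proof.
have [<-|jk] := eqVneq j k; last first.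
  by apply/scommP; rewrite !homX_reflected; apply: scomm_scale; exact: rbase_scomm.
apply: ap_ext => v; rewrite ap_scale ap_add ap_opp sgn_swap.
have [->|ji] := eqVneq j i; first by rewrite tpermL; exact: reflected_XpXm_i.
rewrite bracket_reflected !reflected_kap.
have [aj|nj] := boolP (adjacent_node j); last first.
  rewrite !rbase_far //; move: (nj); rewrite negb_or => /andP[h1 h2].
  rewrite (node_parity_swap_far s ji h1 h2) !tperm_node_l ?tperm_node_r //.
  rewrite ksign_node_l // ksign_node_r // mulr1 !scale1r /rcoef.
  rewrite (negPf ji) (negPf h1) (negPf h2) mulr1 scale1r.
  by rewrite (XX_eq core true) addrAC subrr add0r /xcoef !kap_tor.
(* The factor (Q - Q^-1)^-1 in the coefficient of node i cancels the difference of weights, leaving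
   the coefficient of node j up to sign. *)
have XX' := adjacent_XpXm aj v.
rewrite (node_parity_swap_adj odd_i aj) signrN scaleNr opprK !rbase_adj // XX'.
rewrite xcoef_i /rcoef (negPf ji).
rewrite -[ap (_ * _) v]/(ap (kap rho true j) (ap (kap rho true i) v)).
rewrite -[ap (kap rho false j * _) v]/(ap (kap rho false j) (ap (kap rho false i) v)).
have [h|h] := adjacentP aj.
  have jn : j != i.+1 :> nat by rewrite h; lia.
  rewrite !(kap_prev _ _ h) h eqxx (node_r_prev h) tpermL tperm_node_l //.
  rewrite (ksign_node_l ji jn) ksign_l (wt_prev_i h) !mul1r -/D /=.
  rewrite mulrN mulNr opprK -mulrA mulVf ?QQ_neq0 // mulr1 /xcoef.
  by lcomb F V ltac:(by ring).
have ni : i != j.+1 :> nat by rewrite h; lia.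
rewrite !(kap_next _ _ h) (negPf ni) h eqxx (node_l_next h) tpermR tperm_node_r //.
rewrite (ksign_node_r ji ni) ksign_r (wt_next_i h) -/D.
have -> : (q ^ sgn s l - (q ^ sgn s l)^-1)^-1 = - (Q - Q^-1)^-1 by exact: xcoef_i.
have -> : xcoef q s true j = (Q - Q^-1)^-1 by rewrite /xcoef (node_l_next h).
have -> : (Q - Q^-1)^-1 * - (Q - Q^-1)^-1 * (Q^-1 - Q^-1^-1) = (Q - Q^-1)^-1.
  by rewrite invrK -[_ - Q]opprB mulrN mulrN mulNr opprK -mulrA mulVf ?QQ_neq0 // mulr1.
have tt : (-1) ^+ p j * (-1) ^+ p j = 1 :> F by rewrite -signr_addb addbb expr0.
have -> : - ((-1) ^+ p j * 1) * - ((-1) ^+ p j * D) = D.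
  by rewrite mulrNN mulr1 mulrA tt mul1r.
by rewrite /= -/l; lcomb F V ltac:(by ring).
Qed.

Definition weight b (z : int) (f : endo V) : Prop := forall v,
  ap (rho (K b)) (ap f v) = q ^ z *: ap f (ap (rho (K b)) v).

Lemma weight_mul b z z' f g : weight b z f -> weight b z' g -> weight b (z + z') (f * g).
Proof. by move=> hf hg v; rewrite !ap_mul hf hg ap_lin scalerA expfzDr. Qed.

Lemma weight_sbracket b z z' (c : F) (X Y : bool * endo V) :
  weight b z X.2 -> weight b z' Y.2 -> weight b (z + z') (sbracket c X Y).2.
Proof.
move=> hX hY v; rewrite !ap_sbracket !ap_lin hX hY !ap_lin hY hX !ap_lin.
by rewrite expfzDr //; lcomb F V ltac:(by ring).
Qed.

Lemma weightX b e j : weight b ((-1) ^+ (~~ e) * form_ea s b j) (rho (Xpm e j)).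
Proof. exact: (KX core). Qed.

Lemma weight_kap b f j : weight b 0 (kap rho f j).
Proof.
move=> v; rewrite expr0z scale1r !kap_tor.
by rewrite (torC true f) (torC true (~~ f)).
Qed.

Lemma rbase_weight a e j :
  weight (tperm l r a) ((-1) ^+ (~~ e) * form_ea s' a j) (rbase e j).2.
Proof.
have [->|ji] := eqVneq j i.
  rewrite rbase_i form_ea_swap_i mulrN; case: e => /=.
    have := weight_mul (weight_kap (tperm l r a) false i) (weightX (tperm l r a) false i).
    by rewrite add0r expr1 expr0 mul1r mulN1r.
  have := weight_mul (weightX (tperm l r a) true i) (weight_kap (tperm l r a) true i).
  by rewrite addr0 expr1 expr0 mul1r mulN1r opprK.
have [aj|nj] := boolP (adjacent_node j).
  rewrite rbase_adj // (form_ea_swap_adj odd_i a aj) mulrDr.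
  by case: e; [|rewrite addrC]; apply: weight_sbracket; exact: weightX.
rewrite rbase_far //; move: nj; rewrite negb_or => /andP[h1 h2].
by rewrite form_ea_swap_far //; exact: weightX.
Qed.

Lemma reflected_core : Uq_core q s' reflected.
Proof.
split=> [a|a|a b|a e j|j k].
- apply: ap_ext => v.
  by rewrite ap_mul !ap_scale ap_lin (KKV core) scalerA ksign_sq scale1r.
- apply: ap_ext => v.
  by rewrite ap_mul !ap_scale ap_lin (KVK core) scalerA ksign_sq scale1r.
- apply: ap_ext => v.
  by rewrite !ap_mul !ap_scale !ap_lin (KKC core) !scalerA mulrC.
- apply: ap_ext => v; rewrite reflectedX !ap_mul !ap_scale !ap_lin rbase_weight.
  rewrite (KKV core) !scalerA; congr (_ *: _).
  by move: (rcoef e j) (q ^ _) => c z; case: (ksignP a) => ->; ring.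
- rewrite reflected_XpXm; case: eqP => // _; congr (_ *: _).
Qed.

Let P := kap rho false i * rho (Xm i).
Let M := rho (Xp i) * kap rho true i.
Let t j : F := (-1) ^+ p j.

Lemma homX_reflected_p : homX s' reflected true i = (true, D *: P).
Proof. by rewrite homX_reflected rbase_i /rcoef eqxx. Qed.

Lemma homX_reflected_m : homX s' reflected false i = (true, - D *: M).
Proof. by rewrite homX_reflected rbase_i /rcoef eqxx rmorphN. Qed.

Lemma homX_reflected_adj e j : adjacent_node j ->
  homX s' reflected e j = (~~ p j, rcoef e j *: (rbase e j).2).
Proof. by move=> aj; rewrite homX_reflected rbase_parity (node_parity_swap_adj odd_i aj). Qed.

Let tP j : t j = 1 \/ t j = -1.
Proof. by rewrite /t; case: (p j); [right|left]. Qed.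

Let xi := xcoef q s true i.

Lemma xi_mul (c : F) : - (xi * ((Q - Q^-1) * c)) = c.
Proof. by rewrite /xi xcoef_i mulNr opprK mulKf ?QQ_neq0. Qed.

Let Q0 := Q_neq0.

Lemma reflected_prev_p j v : i = j.+1 :> nat ->
  ap (sbracket Q (homX s' reflected true j) (homX s' reflected true i)).2 v
    = (D * Q) *: ap (rho (Xp j)) v.
Proof.
move=> h; have aj : adjacent_node j by rewrite /adjacent_node h eqxx.
have := adjacent_inv_p aj v; rewrite (wt_prev_i h) -/P -/(t j) -/xi.
have -> : Q ^+ 2 - 1 = (Q - Q^-1) * Q by field; exact: Q_neq0.
rewrite xi_mul => inv; rewrite -scalerA -inv.
rewrite homX_reflected_p homX_reflected_adj // ap_sbracket rbase_adj //.
rewrite (wt_prev_i h) /rcoef (negPf (adjacent_neq aj)) h eqxx.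
rewrite [fst _]/= [X in _ && X]/= andbT signrN -/(t j) /= !ap_scale !ap_lin.
by case: (tP j) => ->; case: DP => ->; lcomb F V ltac:(by field).
Qed.

Lemma reflected_prev_m j v : i = j.+1 :> nat ->
  ap (sbracket Q^-1 (homX s' reflected false i) (homX s' reflected false j)).2 v
    = Q^-1 *: ap (rho (Xm j)) v.
Proof.
move=> h; have aj : adjacent_node j by rewrite /adjacent_node h eqxx.
have := adjacent_inv_m aj v; rewrite (wt_prev_i h) -/M -/(t j) -/xi.
have -> : 1 - Q^-1 ^+ 2 = (Q - Q^-1) * Q^-1 by field; exact: Q_neq0.
rewrite xi_mul => <-.
rewrite homX_reflected_m homX_reflected_adj // ap_sbracket rbase_adj //.
rewrite (wt_prev_i h) /rcoef (negPf (adjacent_neq aj)) h eqxx -/D.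
rewrite [fst _]/= signrN -/(t j) /= !ap_scale !ap_lin.
by case: (tP j) => ->; case: DP => ->; lcomb F V ltac:(by field).
Qed.

Lemma reflected_next_p j v : j = i.+1 :> nat ->
  ap (sbracket Q (homX s' reflected true i) (homX s' reflected true j)).2 v
    = D *: ap (rho (Xp j)) v.
Proof.
move=> h; have aj : adjacent_node j by rewrite /adjacent_node h eqxx orbT.
have ni : i != j.+1 :> nat by rewrite h; lia.
have := adjacent_inv_p aj v; rewrite (wt_next_i h) -/P -/(t j) -/xi.
have -> : Q^-1 ^+ 2 - 1 = (Q - Q^-1) * (- Q^-1) by field; exact: Q_neq0.
(* The bracket here has its arguments in the other order; reversing it costs (-1)^|j| Q, and [rcoef]
   supplies the sign. *)
rewrite xi_mul => /(congr1 (fun w => - Q *: w)).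
rewrite scalerA mulrNN mulfV // scale1r => <-.
rewrite homX_reflected_p homX_reflected_adj // ap_sbracket rbase_adj //.
rewrite (wt_next_i h) /rcoef (negPf (adjacent_neq aj)) (negPf ni) h eqxx.
rewrite [fst _]/= signrN -/(t j) /= !ap_scale !ap_lin.
by case: (tP j) => ->; case: DP => ->; lcomb F V ltac:(by field).
Qed.

Lemma reflected_next_m j v : j = i.+1 :> nat ->
  ap (sbracket Q^-1 (homX s' reflected false j) (homX s' reflected false i)).2 v
    = - ap (rho (Xm j)) v.
Proof.
move=> h; have aj : adjacent_node j by rewrite /adjacent_node h eqxx orbT.
have ni : i != j.+1 :> nat by rewrite h; lia.
have := adjacent_inv_m aj v; rewrite (wt_next_i h) invrK -/M -/(t j) -/xi.
have -> : 1 - Q ^+ 2 = (Q - Q^-1) * (- Q) by field; exact: Q_neq0.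
rewrite xi_mul => /(congr1 (fun w => Q^-1 *: w)).
rewrite scalerA mulrN mulVf // scaleN1r => <-.
rewrite homX_reflected_m homX_reflected_adj // ap_sbracket rbase_adj //.
rewrite (wt_next_i h) /rcoef (negPf (adjacent_neq aj)) (negPf ni) h eqxx -/D.
rewrite [fst _]/= [X in _ && X]/= andbT signrN -/(t j) /= invrK !ap_scale !ap_lin.
by case: (tP j) => ->; case: DP => ->; lcomb F V ltac:(by field).
Qed.

(** Besides identifying the transported representation, this expresses [rho] through the reflected
    operators, which is how irreducibility and generation are transferred. *)
Lemma odd_reflection_reflected g : odd_reflection q s' i reflected g = rho g.
Proof.
have sl : sgn s' l = d by rewrite sgn_swap tpermL.
have sr : sgn s' r = - d by rewrite sgn_swap tpermR (sgn_l odd_i).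
have rp j : reflected (Xp j) = rcoef true j *: (rbase true j).2 by [].
have rm j : reflected (Xm j) = rcoef false j *: (rbase false j).2 by [].
apply: ap_ext => v; case: g => [j|j|a|a]; rewrite /odd_reflection -/l -/r ?sl ?sr.
- rewrite rmorphN -/D opprK; have [->|ji] := eqVneq j i.
    rewrite rm rbase_i /rcoef eqxx rmorphN -/D /= tpermL tpermR ksign_l ksign_r.
    rewrite ap_scale ap_mul [ap (_ * _) (ap _ _)]ap_mul !ap_scale !ap_lin !scalerA.
    rewrite [ap (_ * _) _]ap_mul (kap_torC true) kapKT.
    by rewrite ?rmorphN -/D; case: DP => ->; lcomb F V ltac:(by ring).
  have [h|h] := eqVneq (i : nat) j.+1.
    rewrite ap_scale reflected_prev_p // scalerA -invr_expz -/Q.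
    by rewrite mulrACA D_sq mulVf ?Q_neq0 // mulr1 scale1r.
  have [h'|h'] := eqVneq (j : nat) i.+1.
    by rewrite opprK ap_scale reflected_next_p // scalerA D_sq scale1r.
  rewrite rp ap_scale rbase_far ?negb_or ?h //.
  by rewrite /rcoef (negPf ji) (negPf h) (negPf h') scale1r.
- have [->|ji] := eqVneq j i.
    rewrite rp rbase_i /rcoef eqxx -/D /= tpermL tpermR ksign_l ksign_r.
    rewrite ap_scale ap_mul [ap (_ * _) (ap _ _)]ap_mul !ap_scale !ap_lin !scalerA.
    have kk w : ap (rho (K l)) (ap (rho (Kinv r)) (ap (kap rho false i) w)) = w.
      exact: kapKT.
    rewrite [ap (kap _ _ _ * _) v]ap_mul kk.
    by rewrite -/D; case: DP => ->; lcomb F V ltac:(by ring).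
  have [h|h] := eqVneq (i : nat) j.+1.
    rewrite ap_scale -invr_expz reflected_prev_m // scalerA -/Q.
    by rewrite mulfV ?Q_neq0 // scale1r.
  have [h'|h'] := eqVneq (j : nat) i.+1.
    by rewrite ap_opp -invr_expz reflected_next_m // opprK.
  rewrite rm ap_scale rbase_far ?negb_or ?h //.
  by rewrite /rcoef (negPf ji) (negPf h) (negPf h') scale1r.
- have [->|nl] := eqVneq a l.
    by rewrite ap_scale [reflected _]/reflected tpermR ksign_r scalerA D_sq scale1r.
  have [->|nr] := eqVneq a r.
    rewrite ap_scale [reflected _]/reflected tpermL ksign_l rmorphN.
    by rewrite ap_scale scalerA mulrNN D_sq scale1r.
  rewrite [reflected _]/reflected /ksign (negPf nl) (negPf nr) scale1r.
  by rewrite tpermD // eq_sym.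
- have [->|nl] := eqVneq a l.
    by rewrite ap_scale [reflected _]/reflected tpermR ksign_r scalerA D_sq scale1r.
  have [->|nr] := eqVneq a r.
    rewrite ap_scale [reflected _]/reflected tpermL ksign_l rmorphN.
    by rewrite ap_scale scalerA mulrNN D_sq scale1r.
  rewrite [reflected _]/reflected /ksign (negPf nl) (negPf nr) scale1r.
  by rewrite tpermD // eq_sym.
Qed.

End Reflection.

(** * Subrepresentations and sign twists *)

Section Subrepresentations.
Variables (F : fieldType) (N : nat) (V : lmodType F) (M : set V).

Definition stable_under (f : endo V) : Prop := forall v, M v -> M (f v).

(** Each formula of the odd reflection is a noncommutative polynomial in the operators of [sigma],
    so it preserves whatever they preserve. *)
Lemma subrep_odd_reflection (q : F) (s : N.-tuple bool) (i : 'I_N.-1)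
    (sigma : Uq_ops N V) :
  subrep sigma M -> subrep (odd_reflection q s i sigma) M.
Proof.
move=> [M0 Mlin Mgen]; split=> // g.
have MZ a f : stable_under f -> stable_under (a *: f).
  by move=> h v /h Mv; have := Mlin a _ _ Mv M0; rewrite addr0.
have MM f h : stable_under f -> stable_under h -> stable_under (f * h).
  by move=> hf hh v /hh; exact: hf.
have MB f h : stable_under f -> stable_under h -> stable_under (f - h).
  by move=> hf hh v Mv; have := Mlin (-1) _ _ (hh v Mv) (hf v Mv); rewrite scaleN1r addrC.
have MN f : stable_under f -> stable_under (- f).
  by rewrite -scaleN1r; exact: MZ.
have Mbr a X Y : stable_under X.2 -> stable_under Y.2 -> stable_under (sbracket a X Y).2.
  by move=> hX hY; apply: MB; [exact: MM | apply: MZ; exact: MM].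
suff : stable_under (odd_reflection q s i sigma g) by [].
have Mg h : stable_under (sigma h) by move=> v; exact: Mgen.
rewrite /odd_reflection; case: g => j; do 3?[case: ifP => _] => //.
all: do ?[apply: MZ | apply: MN]; first [exact: Mg | by apply: Mbr; exact: Mg | idtac].
all: by apply: (MM _ _ _ (Mg _)) || apply: (MM _ _ (Mg _)); apply: MM.
Qed.

Lemma subrep_untwist (eps : 'I_N -> bool) (sigma : Uq_ops N V) :
  subrep (sign_twist eps sigma) M -> subrep sigma M.
Proof.
move=> [M0 Mlin Mgen]; split=> // g v Mv.
have MZ (b : bool) u : M ((-1) ^+ b *: u) -> M u.
  move=> h; have := Mlin ((-1) ^+ b) _ _ h M0.
  by rewrite addr0 scalerA -signr_addb addbb expr0 scale1r.
have := Mgen g v Mv.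
case: g => j; [by []|exact: MZ|exact: MZ|exact: MZ].
Qed.

End Subrepresentations.

Section SignTwist.
Variables (F : fieldType) (N : nat) (q : F) (s : N.-tuple bool).
Variables (V : lmodType F) (sigma : Uq_ops N V) (eps : 'I_N -> bool).
Hypothesis core : Uq_core q s sigma.

(** In the mixed relation the torus terms acquire the signs of both ends of the node, exactly the
    sign given to x_i^-. *)
Lemma sign_twist_core : Uq_core q s (sign_twist eps sigma).
Proof.
have sq (b : bool) : (-1) ^+ b * (-1) ^+ b = 1 :> F.
  by rewrite -signr_addb addbb expr0.
have K_sign a v : ap (sign_twist eps sigma (K a)) v = (-1) ^+ eps a *: ap (sigma (K a)) v by [].
have KV_sign a v :
  ap (sign_twist eps sigma (Kinv a)) v = (-1) ^+ eps a *: ap (sigma (Kinv a)) v by [].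
have X_sign e j : exists c, sign_twist eps sigma (Xpm e j) = c *: sigma (Xpm e j).
  by case: e; [exists 1; rewrite scale1r | eexists].
split=> [a|a|a b|a e j|j k].
- by apply: ap_ext => v; rewrite ap_mul K_sign KV_sign ap_lin scalerA sq scale1r (KKV core).
- by apply: ap_ext => v; rewrite ap_mul KV_sign K_sign ap_lin scalerA sq scale1r (KVK core).
- apply: ap_ext => v; rewrite !ap_mul !K_sign !ap_lin (KKC core) !scalerA.
  by rewrite mulrC.
- have [c ->] := X_sign e j; apply: ap_ext => v.
  rewrite !ap_mul K_sign KV_sign !ap_scale !ap_lin (KX core) (KKV core) !scalerA.
  by congr (_ *: _); move: (q ^ _) => z; case: (eps a); rewrite ?expr0 ?expr1; ring.
- have -> : (sbracket 1 (homX s (sign_twist eps sigma) true j)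
      (homX s (sign_twist eps sigma) false k)).2
    = (-1) ^+ (eps (node_l k) (+) eps (node_r k))
        *: (sbracket 1 (homX s sigma true j) (homX s sigma false k)).2.
    apply: ap_ext => v; rewrite ap_scale !ap_sbracket /= !ap_scale !ap_lin.
    by lcomb F V ltac:(by ring).
  rewrite (core_XpXm core); case: eqP => [->|_]; last by rewrite scaler0.
  apply: ap_ext => v; rewrite /= !apE !ap_lin signr_addb.
  by lcomb F V ltac:(by ring).
Qed.

End SignTwist.

(** * The maximal vector after reflection *)

Section Singular.
Variables (F : fieldType) (N : nat) (q : F) (s : N.-tuple bool) (lam : 'I_N -> F).
Hypotheses (q0 : q != 0) (q_root : forall k : nat, (0 < k)%N -> q ^+ k != 1).
Variables (V : lmodType F) (rho : Uq_ops N V) (zeta : V).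
Hypotheses (core : Uq_core q s rho) (irr : irreducible_rep rho).
Hypothesis hw : highest_weight_rep lam rho zeta.

(** Every x_j^+ kills x_i^- zeta: for j = i, kappa_i and its inverse both act on [zeta] by 1.
    Nonempty raising words therefore give 0 and the empty one a deep vector, so [never_top0]
    applies. *)
Lemma lowered_singular0 (i : 'I_N.-1) :
  lam (node_l i) = lam (node_r i) -> ap (rho (Xm i)) zeta = 0.
Proof.
move=> lam_eq; have [zeta0 _ X_zeta K_zeta] := hw.
have [c c0 H_zeta] := height_zeta core zeta0 K_zeta.
apply: (never_top0 q0 q_root core irr hw c0 H_zeta).
elim/last_ind => [|ws j _]; first exact: (deep_lower q0 core hw H_zeta).
rewrite /raise_word foldr_rcons -/(raise_word rho _ _).
have -> : ap (rho (Xp j)) (ap (rho (Xm i)) zeta) = 0.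
  have XZ a : ap (rho (Xp a)) zeta = 0 by exact: X_zeta.
  rewrite (XX core true) XZ !ap_lin scaler0 add0r.
  case: eqP => // ->; rewrite /kap !ap_mul.
  have KV a := Kinv_zeta core zeta0 K_zeta a.
  have KK a : ap (rho (K a)) zeta = lam a *: zeta by exact: K_zeta.
  rewrite !(KK, KV, ap_lin) lam_eq !scalerA.
  by rewrite mulrC subrr scaler0.
by rewrite raise_word0; exact: deep0.
Qed.

End Singular.

Section ReflectedHighestWeight.
Variables (F : fieldType) (N : nat) (q : F) (s : N.-tuple bool) (lam : 'I_N -> F).
Hypotheses (q0 : q != 0) (q_root : forall k : nat, (0 < k)%N -> q ^+ k != 1).
Hypothesis two0 : (2%:R : F) != 0.
Variables (V : lmodType F) (rho : Uq_ops N V) (zeta : V).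
Hypotheses (rep : Uq_rep q s rho) (irr : irreducible_rep rho).
Hypothesis hw : highest_weight_rep lam rho zeta.
Variable i : 'I_N.-1.
Hypotheses (odd_i : node_parity s i) (lam_eq : lam (node_l i) = lam (node_r i)).

Let t := tperm (node_l i) (node_r i).
Let s' := swap_seq i s.

(** The exponent with (-1)^eps = [ksign]: the twist undoes the signs d_i' and d_{i+1}' that beta
    puts on the k's. *)
Definition reflection_sign (a : 'I_N) : bool := ksign F s i a != 1.

Let sigma := reflected q s rho i.
Let twisted := sign_twist reflection_sign sigma.

Let q2 : q ^+ 2 != 1. Proof. exact: q_root. Qed.
Let core := Uq_core_of_rep rep.

Lemma ksign_reflection_sign a : (-1) ^+ reflection_sign a * ksign F s i a = 1.
Proof.
rewrite /reflection_sign; have [->|n1] := eqVneq (ksign F s i a) 1; first by rewrite mulr1.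
by case: (ksignP F s i a) n1 => ->; rewrite ?eqxx // => _; rewrite expr1 mulrNN mulr1.
Qed.

Lemma subrep_of_reflected (M : set V) : subrep sigma M -> subrep rho M.
Proof.
move=> /(subrep_odd_reflection q s' i) [M0 Mlin Mgen]; split=> // g v Mv.
by rewrite -(odd_reflection_reflected q0 q2 two0 rep odd_i g); exact: Mgen.
Qed.

Lemma reflected_irreducible : irreducible_rep sigma.
Proof. by case: irr => nz h; split=> // M /subrep_of_reflected; exact: h. Qed.

Lemma twisted_irreducible : irreducible_rep twisted.
Proof.
by case: irr => nz h; split=> // M /subrep_untwist /subrep_of_reflected; exact: h.
Qed.

(** At node i the new x_i^+ begins with the old x_i^-, which kills [zeta] by the hypothesis on the
    weight; elsewhere only old x^+ occur. *)
Lemma reflected_Xp j : ap (sigma (Xp j)) zeta = 0.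
Proof.
have [_ _ X_zeta _] := hw; have XZ k : ap (rho (Xp k)) zeta = 0 by exact: X_zeta.
rewrite /sigma ap_scale; have [->|ji] := eqVneq j i.
  rewrite rbase_i [X in ap X _]/= ap_mul (lowered_singular0 q0 q_root core irr hw lam_eq).
  by rewrite ap_lin scaler0.
have [aj|nj] := boolP (adjacent_node i j); last by rewrite rbase_far //= XZ scaler0.
by rewrite rbase_adj // ap_sbracket /= !XZ !ap_lin scaler0 subrr scaler0.
Qed.

(** The untwisted module, whose weight carries the signs, is needed as well: transport through beta
    requires its own Serre relations, which come from its being an irreducible highest weight
    module. *)
Lemma reflected_highest_weight :
  highest_weight_rep (fun a => ksign F s i a * lam (t a)) sigma zeta.
Proof.
have [zeta0 gen _ K_zeta] := hw; split=> //.
- by move=> M /subrep_of_reflected; exact: gen.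
- exact: reflected_Xp.
- move=> a; have KZ b : ap (rho (K b)) zeta = lam b *: zeta by exact: K_zeta.
  by rewrite -[LHS]/(ap (sigma (K a)) zeta) ap_scale KZ scalerA.
Qed.

Lemma twisted_highest_weight : highest_weight_rep (fun a => lam (t a)) twisted zeta.
Proof.
have [zeta0 gen Xz Kz] := reflected_highest_weight; split=> //.
- by move=> M /subrep_untwist; exact: gen.
- move=> a; rewrite -[LHS]/((-1) ^+ reflection_sign a *: sigma (K a) zeta) Kz.
  by rewrite scalerA mulrA ksign_reflection_sign mul1r.
Qed.

Lemma reflected_Uq_rep : Uq_rep q s' sigma.
Proof.
apply: (Uq_rep_of_core q0 q_root two0 _ reflected_irreducible reflected_highest_weight).
exact: (reflected_core q0 q2 two0 rep odd_i).
Qed.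

Lemma twisted_core : Uq_core q s' twisted.
Proof. exact: sign_twist_core (reflected_core q0 q2 two0 rep odd_i). Qed.

Lemma twisted_Virr : is_Virr q s' (fun a => lam (t a)) twisted zeta.
Proof.
split; [|exact: twisted_irreducible|exact: twisted_highest_weight].
exact: (Uq_rep_of_core q0 q_root two0 twisted_core twisted_irreducible twisted_highest_weight).
Qed.

End ReflectedHighestWeight.

Theorem proposition3p15 (R : realType) (q lq : R[i])
    (hq0 : q != 0)
    (hq_root : forall k : nat, (0 < k)%N -> q ^+ k != 1)
    (hlq : cexp lq = q)
    (m n : nat) (hN : (2 <= m + n)%N)
    (s : (m + n).-tuple bool) (hs : parity_seq m n s)
    (Lam : 'I_(m + n) -> R[i])
    (V : lmodType R[i]) (rho : Uq_ops (m + n) V) (zeta : V)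
    (hV : is_Virr q s (fun a => qpow lq (sgn s a) (Lam a)) rho zeta)
    (i : 'I_(m + n).-1)
    (hi : tnth s (node_l i) != tnth s (node_r i))
    (hLam : Lam (node_l i) + Lam (node_r i) = 0) :
  let Lam_i := fun a : 'I_(m + n) =>
    let b := tperm (node_l i) (node_r i) a in qpow lq (sgn s b) (Lam b) in
  exists (rho' : Uq_ops (m + n) V) (eps : 'I_(m + n) -> bool),
    [/\ via_odd_reflection q s i rho rho',
        is_Virr q (swap_seq i s) Lam_i (sign_twist eps rho') zeta
      & forall (W : lmodType R[i]) (tau : Uq_ops (m + n) W) (w : W),
          is_Virr q (swap_seq i s) Lam_i tau w ->
          exists phi : {linear V -> W},
            [/\ bijective phi, intertwines (sign_twist eps rho') tau phi
              & phi zeta = w]].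
Proof.
move=> Lam_i; have [rep irr hw] := hV.
have two0 : (2%:R : R[i]) != 0 by rewrite pnatr_eq0.
have odd_i : node_parity s i.
  by rewrite /node_parity; move: hi; case: (tnth s _); case: (tnth s _).
(* Both the signs d_i, d_{i+1} and the exponents Lambda_i, Lambda_{i+1} are opposite, so the
   products in the exponential agree. *)
have lam_eq : qpow lq (sgn s (node_l i)) (Lam (node_l i))
    = qpow lq (sgn s (node_r i)) (Lam (node_r i)).
  rewrite /qpow (sgn_l odd_i) -(addr0_eq hLam); congr cexp.
  by rewrite rmorphN mulNr mulrN mulNr.
have q2 : q ^+ 2 != 1 by exact: hq_root.
exists (reflected q s rho i), (reflection_sign R[i] s i).
have Vtw := twisted_Virr hq0 hq_root two0 rep irr hw odd_i lam_eq.
split=> //.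
- split; first exact: (reflected_Uq_rep hq0 hq_root two0 rep irr hw odd_i lam_eq).
  exact: (odd_reflection_reflected hq0 q2 two0 rep odd_i).
- move=> W tau w [rep' irr' hw'].
  have [rep1 irr1 hw1] := Vtw.
  exact: (Virr_unique hq0 hq_root (Uq_core_of_rep rep1) irr1 hw1
    (Uq_core_of_rep rep') irr' hw').
Qed.
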